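(* Let $n \in \mathbb{N}$. There exists a semigroup identity satisfied by $\mathbb{P}_n$ but not by $UT_{n+1}(\mathbb{T})$.
   Context: $\mathbb{N} = \{1,2,\dots\}$. For an alphabet $\Sigma$, $\Sigma^+$ is the semigroup of all non-empty words over $\Sigma$ under concatenation. A semigroup identity ''$u=v$'' is a pair of distinct non-empty words over an alphabet $\Sigma$; a semigroup $S$ satisfies $u=v$ if every semigroup morphism $\Sigma^+ \to S$ maps $u$ and $v$ to the same element of $S$. The plactic monoid of rank $n$, $\mathbb{P}_n$, is the monoid generated by $\{1,\dots,n\}$ subject to the Knuth relations: $bca = bac$ for $1 \le a < b \le c \le n$, and $cab = acb$ for $1 \le a \le b < c \le n$. The tropical semiring $\mathbb{T}$ is $\mathbb{R} \cup \{-\infty\}$ with semiring addition $x \oplus y = \max(x,y)$ and semiring multiplication given by ordinary addition $x + y$. $UT_m(\mathbb{T})$ is the semigroup, under tropical matrix multiplication, of all $m \times m$ matrices over $\mathbb{T}$ in which every entry below the diagonal is $-\infty$. *)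

(* Defs.v *)
From HB Require Import structures.
From mathcomp Require Import all_boot all_order all_algebra.
From mathcomp Require Import boolp reals constructive_ereal.

Set Implicit Arguments.
Unset Strict Implicit.
Unset Printing Implicit Defensive.

Import Order.TTheory GRing.Theory.

Local Open Scope group_scope.

Record free_semigroup (Sigma : choiceType) := FreeSemigroup {
  word_of :> seq Sigma;
  word_of_neq_nil : word_of != [::]
}.

Section FreeSemigroup.
Variable Sigma : choiceType.
Implicit Types u v w : free_semigroup Sigma.

HB.instance Definition _ := [isSub for @word_of Sigma].
HB.instance Definition _ := [Choice of free_semigroup Sigma by <:].

Lemma fsg_mul_subproof u v : word_of u ++ word_of v != [::].
Proof. by case: u => -[]. Qed.

Definition fsg_mul u v : free_semigroup Sigma :=
  FreeSemigroup (fsg_mul_subproof u v).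

Lemma fsg_mulA : associative fsg_mul.
Proof. by move=> u v w; apply: val_inj; rewrite /= catA. Qed.

HB.instance Definition _ :=
  isSemigroup.Build (free_semigroup Sigma) fsg_mulA.

End FreeSemigroup.

(* [{multiplicative _ -> _}] is the type of morphisms of magmas: nothing is
   required of the unit when [S] happens to be a monoid. *)
Definition satisfies_identity (S : semigroupType) (Sigma : choiceType)
    (u v : free_semigroup Sigma) : Prop :=
  forall f : {multiplicative free_semigroup Sigma -> S}, f u = f v.

(* The generators 1 < ... < n are represented by the elements 0 < ... < n - 1
   of ['I_n]. *)
Inductive knuth_relation (n : nat) : seq 'I_n -> seq 'I_n -> Prop :=
| knuth_bca (a b c : 'I_n) of (a < b)%N & (b <= c)%N :
    knuth_relation [:: b; c; a] [:: b; a; c]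
| knuth_cab (a b c : 'I_n) of (a <= b)%N & (b < c)%N :
    knuth_relation [:: c; a; b] [:: a; c; b].

(* The least congruence on words containing the Knuth relations. *)
Inductive plactic_congr (n : nat) : seq 'I_n -> seq 'I_n -> Prop :=
| plactic_knuth u v of knuth_relation u v : plactic_congr u v
| plactic_refl u : plactic_congr u u
| plactic_sym u v of plactic_congr u v : plactic_congr v u
| plactic_trans u v w of plactic_congr u v & plactic_congr v w :
    plactic_congr u w
| plactic_cat u u' v v' of plactic_congr u u' & plactic_congr v v' :
    plactic_congr (u ++ v) (u' ++ v').

Section Plactic.
Variable n : nat.

Definition plactic_rel (u v : seq 'I_n) : bool := `[< plactic_congr u v >].

Lemma plactic_rel_refl : reflexive plactic_rel.
Proof. by move=> u; apply/asboolP/plactic_refl. Qed.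

Lemma plactic_rel_sym : symmetric plactic_rel.
Proof. by move=> u v; apply/asboolP/asboolP; apply: plactic_sym. Qed.

Lemma plactic_rel_trans : transitive plactic_rel.
Proof.
by move=> v u w /asboolP uv /asboolP vw; apply/asboolP/(plactic_trans uv).
Qed.

Canonical plactic_equiv :=
  EquivRel plactic_rel plactic_rel_refl plactic_rel_sym plactic_rel_trans.

Definition plactic := {eq_quot plactic_rel}%qT.

HB.instance Definition _ := Choice.on plactic.

Definition plactic_class (w : seq 'I_n) : plactic := (\pi_plactic w)%qT.

Lemma plactic_classP u v :
  plactic_class u = plactic_class v <-> plactic_congr u v.
Proof.
by split=> [/eqquotP/asboolP | uv] //; apply/eqquotP/asboolP.
Qed.

Lemma plactic_classK (x : plactic) : plactic_class (repr x) = x.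
Proof. exact: reprK. Qed.

Definition plactic_mul (x y : plactic) : plactic :=
  plactic_class (repr x ++ repr y).

Lemma plactic_mul_class u v :
  plactic_mul (plactic_class u) (plactic_class v) = plactic_class (u ++ v).
Proof.
by apply/plactic_classP/plactic_cat; apply/plactic_classP/plactic_classK.
Qed.

Lemma plactic_mulA : associative plactic_mul.
Proof.
move=> x y z.
rewrite -(plactic_classK x) -(plactic_classK y) -(plactic_classK z).
by rewrite !plactic_mul_class catA.
Qed.

Lemma plactic_mul1 : left_id (plactic_class [::]) plactic_mul.
Proof. by move=> x; rewrite -(plactic_classK x) plactic_mul_class. Qed.

Lemma plactic_mulr1 : right_id (plactic_class [::]) plactic_mul.
Proof. by move=> x; rewrite -(plactic_classK x) plactic_mul_class cats0. Qed.

HB.instance Definition _ :=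
  isMonoid.Build plactic plactic_mulA plactic_mul1 plactic_mulr1.

End Plactic.

(* The reals together with -oo, as extended reals other than +oo. *)
Record tropical (R : realType) := Tropical {
  trop_val : \bar R;
  trop_val_neqy : (trop_val != +oo)%E
}.

Section Tropical.
Variable R : realType.
Implicit Types x y z : tropical R.

HB.instance Definition _ := [isSub for @trop_val R].
HB.instance Definition _ := [Choice of tropical R by <:].

Lemma trop_add_subproof x y : (maxe (trop_val x) (trop_val y) != +oo)%E.
Proof. by case: x => x px; case: y => y py; rewrite /= maxEle; case: ifP. Qed.

Lemma trop_mul_subproof x y : (trop_val x + trop_val y != +oo)%E.
Proof. by case: x => -[x| |] // px; case: y => -[y| |]. Qed.

Definition trop_zero : tropical R := @Tropical R (-oo)%E isT.
Definition trop_one : tropical R := @Tropical R 0%E isT.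
Definition trop_add x y : tropical R := Tropical (trop_add_subproof x y).
Definition trop_mul x y : tropical R := Tropical (trop_mul_subproof x y).

Lemma trop_addA : associative trop_add.
Proof. by move=> x y z; apply: val_inj; rewrite /= maxA. Qed.

Lemma trop_addC : commutative trop_add.
Proof. by move=> x y; apply: val_inj; rewrite /= maxC. Qed.

Lemma trop_add0 : left_id trop_zero trop_add.
Proof. by move=> x; apply: val_inj; rewrite /= maxNye. Qed.

Lemma trop_mulA : associative trop_mul.
Proof. by move=> x y z; apply: val_inj; rewrite /= addeA. Qed.

Lemma trop_mulC : commutative trop_mul.
Proof. by move=> x y; apply: val_inj; rewrite /= addeC. Qed.

Lemma trop_mul1 : left_id trop_one trop_mul.
Proof. by move=> x; apply: val_inj; rewrite /= add0e. Qed.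

Lemma trop_mulDl : left_distributive trop_mul trop_add.
Proof. by move=> x y z; apply: val_inj; rewrite /= adde_maxl. Qed.

Lemma trop_mul0 : left_zero trop_zero trop_mul.
Proof. by move=> x; apply: val_inj; rewrite /= addNye. Qed.

Lemma trop_one_neq0 : trop_one != trop_zero.
Proof. by []. Qed.

HB.instance Definition _ :=
  GRing.isNmodule.Build (tropical R) trop_addA trop_addC trop_add0.
HB.instance Definition _ := GRing.Nmodule_isComNzSemiRing.Build (tropical R)
  trop_mulA trop_mulC trop_mul1 trop_mulDl trop_mul0 trop_one_neq0.

End Tropical.

(* [0%R] is the zero of the tropical semiring, that is -oo, and [*m] is the
   matrix product over that semiring. *)
Record UT (R : realType) (m : nat) := UTMatrix {
  UT_mx :> 'M[tropical R]_m;
  UT_mx_upper : [forall i : 'I_m, forall j : 'I_m,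
                  (j < i)%N ==> (UT_mx i j == 0%R)]
}.

Section UpperTriangular.
Variables (R : realType) (m : nat).
Implicit Types A B C : UT R m.

HB.instance Definition _ := [isSub for @UT_mx R m].
HB.instance Definition _ := [Choice of UT R m by <:].

Lemma UT_mx0 A (i j : 'I_m) : (j < i)%N -> UT_mx A i j = 0%R.
Proof.
have /forallP/(_ i)/forallP/(_ j)/implyP Aij0 := UT_mx_upper A.
by move=> /Aij0/eqP.
Qed.

Lemma UT_mul_subproof A B : [forall i : 'I_m, forall j : 'I_m,
  (j < i)%N ==> ((UT_mx A *m UT_mx B)%R i j == 0%R)].
Proof.
apply/forallP => i; apply/forallP => j; apply/implyP => ji.
rewrite mxE big1 // => k _; have [ki|ik] := ltnP k i.
  by rewrite UT_mx0 // mul0r.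
by rewrite (UT_mx0 B) ?mulr0 // (leq_trans ji).
Qed.

Definition UT_mul A B : UT R m := UTMatrix (UT_mul_subproof A B).

Lemma UT_mulA : associative UT_mul.
Proof. by move=> A B C; apply: val_inj; rewrite /= mulmxA. Qed.

HB.instance Definition _ := isSemigroup.Build (UT R m) UT_mulA.

End UpperTriangular.

(* Main.v *)
(* The identity. Write A = xy and B = yx. Let w be a concatenation of n(n+1) copies of
   a word that has every word of length at most n - 1 in A and B as a factor, but
   not A^n, and let w' be its reversal. The identity is w A^n w' = w B^n w'.

   In UT_{n+1}(T) it fails for bidiagonal images of A and B whose extreme diagonal
   entries are 1 and whose other diagonal entries are 0: the corner entry of a product
   rewards performing the n off-diagonal steps at n consecutive factors A, which is
   possible on the left hand side only.

   In P_n, a word is determined by the numbers (Greene) of letters covered by k disjoint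
   nondecreasing subsequences with letters below j. Such a family is a nonincreasing
   sequence of states, a state being a k-subset of {0, ..., j-1}. The images of A and
   B have the same content, so it is best to stay in the k-subset P* of the most frequent
   letters, and the claim is that an optimal family may be assumed to be in state
   P* throughout the middle block A^n or B^n, where the two words differ. By modularity
   a family splits into a part below P* and a part above P*. The part below P* is
   described by its height function over P*, whose level sets contribute independently
   to the total; each level set changes at most n - 1 times, so its changes can be
   compressed into a free copy of the rich word inside w without losing anything. The
   part above P* is handled by reversing time. *)
From HB Require Import structures.
Require Import Defs.
From mathcomp Require Import all_boot all_order all_algebra.
From mathcomp Require Import boolp reals constructive_ereal.
From mathcomp Require Import zify.

Set Implicit Arguments.
Unset Strict Implicit.
Unset Printing Implicit Defensive.

Import Order.TTheory GRing.Theory Num.Theory.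

(** * States and their trajectories *)

(* A state, that is a finite set of letters, is represented by the function [H] counting
   its elements below a given letter. Moving elements up lowers [H]. *)
Definition steps (H : nat -> nat) := forall x, H x <= H x.+1 <= (H x).+1.

Definition hit (H : nat -> nat) x := H x.+1 - H x.

Definition below (Q P : nat -> nat) := forall x, Q x <= P x.

(* [reach W P Q v]: reading [W], a nonincreasing sequence of states between [P] and [Q]
   contains the letter being read [v] times. *)
Inductive reach :
    seq nat -> (nat -> nat) -> (nat -> nat) -> nat -> Prop :=
| reach_nil P Q of below Q P : reach [::] P Q 0
| reach_cons x W P S Q v of steps S & below S P & reach W S Q v :
    reach (x :: W) P Q (hit S x + v).

Lemma below_refl P : below P P. Proof. by move=> x. Qed.

Lemma below_trans S P Q : below S P -> below Q S -> below Q P.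
Proof. by move=> SP QS x; apply: leq_trans (QS x) (SP x). Qed.

Lemma steps_lip H x d : steps H -> H x <= H (x + d) <= H x + d.
Proof.
move=> sH; elim: d => [|d IH]; first by rewrite !addn0 leqnn.
by have := sH (x + d); rewrite addnS; lia.
Qed.

Lemma steps_le H x y : steps H -> x <= y -> H x <= H y /\ H y <= H x + (y - x).
Proof.
move=> sH xy; have := steps_lip x (y - x) sH.
by rewrite subnKC // => /andP[].
Qed.

Lemma reach_below W P Q v : reach W P Q v -> below Q P.
Proof. by elim=> // {}x {}W {}P S {}Q {}v _ SP _ QS; apply: below_trans QS. Qed.

Lemma reach_sub W P P' Q v : below P P' -> reach W P Q v -> reach W P' Q v.
Proof.
move=> PP' r; case: r PP' => [{}P {}Q QP|x {}W {}P S {}Q {}v sS SP r] PP'.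
  by constructor; apply: below_trans QP.
by apply: reach_cons r => //; apply: below_trans SP.
Qed.

Lemma reach_cat U W P S Q v v' :
  reach U P S v -> reach W S Q v' -> reach (U ++ W) P Q (v + v').
Proof.
move=> r; elim: r W Q v' => [{}P {}S SP|x {}U {}P S' {}S {}v sS SP _ IH] W Q v' r'.
  exact: reach_sub r'.
by rewrite -addnA /=; apply: reach_cons => //; apply: IH.
Qed.

Lemma reach_nilE P Q v : reach [::] P Q v -> below Q P /\ v = 0.
Proof. by move=> r; inversion r. Qed.

Lemma reach_consE x W P Q v : reach (x :: W) P Q v ->
  exists S v', [/\ steps S, below S P, reach W S Q v' & v = hit S x + v'].
Proof. by move=> r; inversion r; subst; do 2!eexists; split; eauto. Qed.

Lemma reach_split U W P Q v : reach (U ++ W) P Q v ->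
  exists S v1 v2, [/\ reach U P S v1, reach W S Q v2 & v = v1 + v2].
Proof.
elim: U P v => [|x U IH] P v /= r.
  by exists P, 0, v; split=> //; constructor.
have {r}[S [{}v [sS SP r' ->]]] := reach_consE r.
have [S' [v1 [v2 [r1 r2 ->]]]] := IH _ _ r'.
by exists S', (hit S x + v1), v2; split=> //; [apply: reach_cons|rewrite addnA].
Qed.

(** Both end states are arbitrary, which makes domination compatible with concatenation and reduces
    the Knuth relations to words of three letters. *)
Definition dominated U U' := forall P Q v, reach U P Q v ->
  exists2 v', v <= v' & reach U' P Q v'.

Lemma dominated_cat U U' W W' :
  dominated U U' -> dominated W W' -> dominated (U ++ W) (U' ++ W').
Proof.
move=> dU dW P Q v /reach_split[S [v1 [v2 [r1 r2 ->]]]].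
have [v1' le1 {}r1] := dU _ _ _ r1; have [v2' le2 {}r2] := dW _ _ _ r2.
by exists (v1' + v2'); [apply: leq_add|apply: reach_cat r2].
Qed.

Lemma reach3 x y z P Q S1 S2 S3 : steps S1 -> steps S2 -> steps S3 ->
  below S1 P -> below S2 S1 -> below S3 S2 -> below Q S3 ->
  reach [:: x; y; z] P Q (hit S1 x + hit S2 y + hit S3 z).
Proof.
move=> *; rewrite -!addnA -[hit S3 z]addn0.
by do 3!(apply: reach_cons; eauto); constructor.
Qed.

Lemma reach3E x y z P Q v : reach [:: x; y; z] P Q v ->
  exists S1 S2 S3, [/\ [/\ steps S1, steps S2 & steps S3],
    [/\ below S1 P, below S2 S1, below S3 S2 & below Q S3]
    & v = hit S1 x + hit S2 y + hit S3 z].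
Proof.
move=> /reach_consE[S1 [v1 [s1 b1 + ->]]].
move=> /reach_consE[S2 [v2 [s2 b2 + ->]]].
move=> /reach_consE[S3 [v3 [s3 b3 + ->]]].
by move=> /reach_nilE[b ->]; exists S1, S2, S3; split=> //; lia.
Qed.

(** * Knuth relations acting on sequences of states *)

Lemma hit01 H x : steps H -> hit H x <= 1.
Proof. by move=> /(_ x); rewrite /hit; lia. Qed.

(* The state [H] with its largest element at most [c] moved to [c]. *)
Definition raise_to H c x := if x <= c then minn (H x) (H c.+1).-1 else H x.

(* The state [H] with its smallest element at least [c] moved to [c]. *)
Definition lower_to H c x := if x <= c then H x else maxn (H x) (H c).+1.

Lemma raise_steps H c : steps H -> 0 < H c.+1 -> steps (raise_to H c).
Proof.
move=> sH Hc x; rewrite /raise_to; have := sH x.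
have [xc|xc|<-] := ltngtP x c; last lia.
  by have := steps_le sH (xc : x.+1 <= c); have := sH c; lia.
by lia.
Qed.

Lemma lower_steps H c : steps H -> steps (lower_to H c).
Proof.
move=> sH x; rewrite /lower_to; have := sH x.
have [xc|xc|<-] := ltngtP x c; last lia.
  by lia.
by have := steps_le sH xc; lia.
Qed.

Lemma raise_hit H c : 0 < H c.+1 -> steps H -> hit (raise_to H c) c = 1.
Proof. by move=> Hc /(_ c); rewrite /hit /raise_to leqnn ltnn; lia. Qed.

Lemma raise_below H c : below (raise_to H c) H.
Proof. by move=> x; rewrite /raise_to; case: ifP => // _; apply: geq_minl. Qed.

Lemma below_raise H Q c : steps H -> steps Q -> below Q H -> 0 < hit Q c ->
  below Q (raise_to H c).
Proof.
move=> sH sQ QH Qc x; rewrite /raise_to /hit in Qc *; case: ifP => // xc.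
have := steps_le sQ xc; have := QH x; have := QH c.+1; have := sQ c; lia.
Qed.

Lemma hit_gt H c : hit H c > 0 -> 0 < H c.+1.
Proof. rewrite /hit; lia. Qed.


(** Moving the largest element of [P] that is at most [a] onto [a] keeps [c], and does not pass [Q],
    which contains [a] itself. *)
Lemma hit_exchange P Q a c : steps P -> steps Q -> below Q P -> a < c ->
  0 < hit P c -> 0 < hit Q a ->
  exists S, [/\ steps S, below S P, below Q S, 0 < hit S c & 0 < hit S a].
Proof.
move=> sP sQ QP ac Pc Qa.
have Pa : 0 < P a.+1 := leq_trans (hit_gt Qa) (QP _).
exists (raise_to P a); split; rewrite ?raise_hit //.
- exact: raise_steps.
- exact: raise_below.
- exact: below_raise.
- by move: Pc; rewrite /hit /raise_to !ifF //; lia.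
Qed.

(** When both letters are hit, one intermediate state contains both and reads them in any order;
    otherwise one of the two states is used twice. *)
Lemma dominated_ca a c : a < c -> dominated [:: c; a] [:: a; c].
Proof.
move=> ac P Q v /reach_consE[S1 [v1 [s1 b1 + ->]]].
move=> /reach_consE[S2 [v2 [s2 b2 + ->]]].
move=> /reach_nilE[b3 ->].
have r2 S T : steps S -> steps T -> below S P -> below T S -> below Q T ->
    reach [:: a; c] P Q (hit S a + (hit T c + 0)).
  by move=> *; do 2!(apply: reach_cons; eauto); constructor.
have c1 := hit01 c s1; have a1 := hit01 a s2.
have [h1|h1] := posnP (hit S1 c).
  exists (hit S2 a + (hit S2 c + 0)); [lia|].
  by apply: r2; eauto using below_trans, below_refl.
have [h2|h2] := posnP (hit S2 a).
  exists (hit S1 a + (hit S1 c + 0)); [lia|].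
  by apply: r2; eauto using below_trans, below_refl.
have [S [sS S1S SS2 Sc Sa]] := hit_exchange s1 s2 b2 ac h1 h2.
exists (hit S a + (hit S c + 0)); [lia|].
by apply: r2; eauto using below_trans, below_refl.
Qed.

Lemma dominated_bac_bca a b c : a < b -> b <= c ->
  dominated [:: b; a; c] [:: b; c; a].
Proof.
move=> ab bc P Q v /reach3E[H1 [H2 [H3 [[s1 s2 s3] [b0 b1 b2 b3] ->]]]].
have := (hit01 b s1, hit01 a s2, hit01 c s3) => -[[hb ha] hc].
suff [S1 [S2 [S3 [[t1 t2 t3] [c1 c2 c3 c4] le]]]] : exists S1 S2 S3,
    [/\ [/\ steps S1, steps S2 & steps S3],
    [/\ below S1 H1, below S2 S1, below S3 S2 & below H3 S3]
    & hit H1 b + hit H2 a + hit H3 c <= hit S1 b + hit S2 c + hit S3 a].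
  exists (hit S1 b + hit S2 c + hit S3 a) => //.
  by apply: reach3; eauto using below_trans.
have b13 : below H3 H1 by eauto using below_trans.
have use S : steps S -> below S H1 -> below H3 S ->
    hit H2 a + hit H3 c <= hit S c + hit S a -> exists S1 S2 S3,
    [/\ [/\ steps S1, steps S2 & steps S3],
    [/\ below S1 H1, below S2 S1, below S3 S2 & below H3 S3]
    & hit H1 b + hit H2 a + hit H3 c <= hit S1 b + hit S2 c + hit S3 a].
  by move=> *; exists H1, S, S; split=> //; [split=> //; apply: below_refl|lia].
(* If [a] is missed, [H3] serves for both letters; if [c] is missed, [H2] does. *)
have [h2|h2] := posnP (hit H2 a); first by apply: (use H3); [..|lia].
have [h3|h3] := posnP (hit H3 c); first by apply: (use H2); [..|lia].
have H2c : 0 < H2 c.+1 := leq_trans (hit_gt h3) (b2 _).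
have ac : a < c by lia.
(* If [H2] has an element after [a] and up to [c], the largest such element is moved onto [c] and
   [a] is kept. *)
have [h|h] := ltnP (H2 a.+1) (H2 c.+1).
  apply: (use (raise_to H2 c)).
  - exact: raise_steps.
  - exact: below_trans (raise_below _ _).
  - exact: below_raise.
  - rewrite raise_hit //.
    by move: h2 ha hc; rewrite /hit /raise_to (ltnW ac) ac; lia.
have e : H2 c.+1 = H2 a.+1 by have := steps_le s2 (ltnW ac : a.+1 <= c.+1); lia.
(* If [b] is missed, only two hits have to be matched: the element [a] of [H2] moves to [b], then to
   [c]. *)
have [h1|h1] := posnP (hit H1 b).
  have H2b : 0 < H2 b.+1.
    by have := steps_le s2 (leqW ab : a.+1 <= b.+1); have := hit_gt h2; lia.
  exists (raise_to H2 b), (raise_to H2 c), (raise_to H2 c).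
  split; last by rewrite !raise_hit //; lia.
    by split; apply: raise_steps.
  split; try exact: below_refl.
  - exact: below_trans (raise_below _ _).
  - have /andP[_ _] := s2 b.
    have e' : H2 b.+1 = H2 c.+1.
      have := steps_le s2 (leqW ab : a.+1 <= b.+1).
      by have := steps_le s2 (bc : b.+1 <= c.+1); lia.
    move=> x; rewrite /raise_to e'; case: (leqP x b) => xb; case: ifP => xc; try lia.
  - exact: below_raise.
(* As [H1] contains [b], it has more elements up to [c] than [H2], which leaves room to lower the
   next element of [H2] to [c]. *)
apply: (use (lower_to H2 c)); first exact: lower_steps.
- move=> x; rewrite /lower_to; have := b1 x; case: ifP => // xc.
  have := steps_le s1 (_ : c < x); have := steps_le s1 (bc : b < c.+1).
  have := b1 b; have := steps_le s2 (ab : a.+1 <= b); have := steps_le s2 bc.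
  move: h1; rewrite /hit; have := s2 c; lia.
- by move=> x; rewrite /lower_to; have := b2 x; case: ifP; lia.
- have := steps_le s2 ac; move: h2 ha hc; have := s2 c.
  by rewrite /hit /lower_to (ltnW ac) ac leqnn ltnn; lia.
Qed.

Lemma lower_hit H c : steps H -> hit (lower_to H c) c = 1.
Proof. by move=> /(_ c); rewrite /hit /lower_to leqnn ltnn; lia. Qed.

Lemma below_lower H c : below H (lower_to H c).
Proof. by move=> x; rewrite /lower_to; case: ifP => // _; apply: leq_maxl. Qed.

Lemma lower_below H P c : steps H -> steps P -> below H P -> 0 < hit P c ->
  below (lower_to H c) P.
Proof.
move=> sH sP HP Pc x; rewrite /lower_to /hit in Pc *; have := HP x.
case: (leqP x c) => //= xc HPx.
by have := steps_le sP xc; have := HP c; lia.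
Qed.

(** Mirror image of [dominated_bac_bca]: raising and lowering, and the outer states [H1] and [H3],
    exchange their roles. *)
Lemma dominated_acb_cab a b c : a <= b -> b < c ->
  dominated [:: a; c; b] [:: c; a; b].
Proof.
move=> ab bc P Q v /reach3E[H1 [H2 [H3 [[s1 s2 s3] [b0 b1 b2 b3] ->]]]].
have := (hit01 a s1, hit01 c s2, hit01 b s3) => -[[ha hc] hb].
suff [S1 [S2 [S3 [[t1 t2 t3] [c1 c2 c3 c4] le]]]] : exists S1 S2 S3,
    [/\ [/\ steps S1, steps S2 & steps S3],
    [/\ below S1 H1, below S2 S1, below S3 S2 & below H3 S3]
    & hit H1 a + hit H2 c + hit H3 b <= hit S1 c + hit S2 a + hit S3 b].
  exists (hit S1 c + hit S2 a + hit S3 b) => //.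
  by apply: reach3; eauto using below_trans.
have b13 : below H3 H1 by eauto using below_trans.
have use S : steps S -> below S H1 -> below H3 S ->
    hit H1 a + hit H2 c <= hit S c + hit S a -> exists S1 S2 S3,
    [/\ [/\ steps S1, steps S2 & steps S3],
    [/\ below S1 H1, below S2 S1, below S3 S2 & below H3 S3]
    & hit H1 a + hit H2 c + hit H3 b <= hit S1 c + hit S2 a + hit S3 b].
  by move=> *; exists S, S, H3; split=> //; [split=> //; apply: below_refl|lia].
have [h1|h1] := posnP (hit H1 a); first by apply: (use H2); [..|lia].
have [h2|h2] := posnP (hit H2 c); first by apply: (use H1); [..|lia].
have ac : a < c by lia.
have lowH1 : below (lower_to H2 a) H1 by apply: lower_below.
have [h|h] := ltnP (H2 a) (H2 c).
  apply: (use (lower_to H2 a)) => //.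
  - exact: lower_steps.
  - exact: below_trans (below_lower _ _) _.
  - rewrite lower_hit //.
    move: h2 ha hc; rewrite /hit /lower_to.
    by rewrite (leqNgt c a) (leqNgt c.+1 a) ac (leqW ac) /=; lia.
have e x : a <= x -> x <= c -> H2 x = H2 a.
  by move=> ax xc; have := steps_le s2 ax; have := steps_le s2 xc; lia.
have [h3|h3] := posnP (hit H3 b).
  exists H1, (lower_to H2 a), (lower_to H2 b).
  split; last by rewrite !lower_hit //; lia.
    by split=> //; apply: lower_steps.
  split=> //.
  - move=> x; rewrite /lower_to (e b) //; last exact: ltnW.
    by case: (leqP x a) => xa; case: ifP; lia.
  - exact: below_trans (below_lower _ _) _.
have H2a : H2 b.+1 = H2 a.+1 by rewrite !e // leqW.
have H2a' := e a.+1 (leqnSn a) ac.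
have H2a0 : 0 < H2 a.+1 by have := b2 b.+1; have := hit_gt h3; lia.
apply: (use (raise_to H2 a)); first exact: raise_steps.
- exact: below_trans (raise_below _ _).
- move=> x; rewrite /raise_to; have := b2 x; case: ifP => // xa.
  have := steps_le s3 xa; have := steps_le s3 ab; have := b2 b.+1.
  move: h3; rewrite /hit; have := s3 b; lia.
- rewrite raise_hit //; move: h2 ha hc; rewrite /hit /raise_to.
  by rewrite (leqNgt c a) (leqNgt c.+1 a) ac (leqW ac) /=; lia.
Qed.

Lemma dominated_trans U V W : dominated U V -> dominated V W -> dominated U W.
Proof.
move=> dU dV P Q v /dU[v1 le1 /dV[v2 le2 r]].
by exists v2 => //; apply: leq_trans le2.
Qed.

Lemma dominated_refl U : dominated U U.
Proof. by move=> P Q v r; exists v. Qed.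

Definition vals n (w : seq 'I_n) := map (@nat_of_ord n) w.

Lemma plactic_dominated n (u v : seq 'I_n) : plactic_congr u v ->
  dominated (vals u) (vals v) /\ dominated (vals v) (vals u).
Proof.
have r x : dominated [:: x] [:: x] by apply: dominated_refl.
elim=> {u v} [u v []|u|u v _ [? ?]|u v w _ [? ?] _ [? ?]|u u' v v' _ [? ?] _ [? ?]].
- move=> a b c ab bc; split; last exact: dominated_bac_bca.
  apply: (dominated_cat (U := [:: _]) (U' := [:: _])) (r b) _.
  by apply: dominated_ca; lia.
- move=> a b c ab bc; split; last exact: dominated_acb_cab.
  apply: (dominated_cat (U := [:: _; _]) (U' := [:: _; _])) _ (r b).
  by apply: dominated_ca; lia.
- by split; apply: dominated_refl.
- by split.
- by split; eauto using dominated_trans.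
- by rewrite /vals !map_cat; split; apply: dominated_cat.
Qed.

(** * Row insertion *)

(** Row [s] may stand directly beneath row [r] in a tableau. *)
Definition dom (r s : seq nat) :=
  size s <= size r /\ forall p, p < size s -> nth 0 r p < nth 0 s p.

Fixpoint is_tab (t : seq (seq nat)) : Prop :=
  if t is r :: t' then [/\ sorted leq r, dom r (head [::] t') & is_tab t']
  else True.

(** Schensted insertion: [x] replaces the first larger entry. If there is none, [find] returns
    [size r] and [set_nth] appends. *)
Definition row_ins x r := set_nth 0 r (find (ltn x) r) x.

Lemma row_ins_sorted x r : sorted leq r -> sorted leq (row_ins x r).
Proof.
rewrite /row_ins; elim: r => [|y r IH] //= sr.
case: ltnP => [xy|yx] /=.
  by case: r sr {IH} => //= z r /andP[yz ->]; rewrite andbT; lia.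
have := IH (path_sorted sr); case: r sr {IH} => [|z r] /=; first by rewrite yx.
by move=> /andP[yz _]; case: ifP => /= _ ->; rewrite ?yx ?yz.
Qed.

(** The bumped entry [y] lands in a column [q <= p], because the entry beneath it, if any, is larger
    than [y]. *)
Lemma dom_row_ins x r s p : dom r s -> find (ltn x) r = p -> p < size r ->
  dom (row_ins x r) (row_ins (nth 0 r p) s).
Proof.
move=> [rs ds] ep pr; have xp : x < nth 0 r p.
  by rewrite -ep; apply: (@nth_find _ 0 (ltn x)); rewrite has_find ep.
set y := nth 0 r p in xp *; set q := find (ltn y) s.
have qp : q <= p.
  case: (ltnP p (size s)) => [ps|sp]; last exact: leq_trans (find_size _ _) sp.
  rewrite leqNgt; apply/negP => pq.
  by have := before_find 0 pq; rewrite /= ds.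
split=> [|i]; first by rewrite !size_set_nth -/q ep; lia.
rewrite !size_set_nth -/q => iq; rewrite /row_ins !nth_set_nth /= -/q ep.
have ri : (if i == p then x else nth 0 r i) <= nth 0 r i.
  by case: eqP => // ->; apply: ltnW.
have [->|iq'] := eqVneq i q.
  have [//|qp'] := eqVneq q p.
  have qp2 : q < find (ltn x) r by rewrite ep; lia.
  by have := before_find 0 qp2; rewrite /= ; lia.
have qs : q <= size s := find_size _ _.
by apply: leq_ltn_trans ri _; apply: ds; lia.
Qed.

Section Insertion.
Variable n : nat.
Implicit Types (r : seq 'I_n) (t : seq (seq 'I_n)).

Lemma plactic_cons (x : 'I_n) u v :
  plactic_congr u v -> plactic_congr (x :: u) (x :: v).
Proof. by move=> uv; apply: (plactic_cat (plactic_refl [:: x])). Qed.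

(** The new letter [x] travels left to [y] by repeated use of bca = bac. *)
Lemma plactic_bump_right (x y : 'I_n) r : sorted leq (vals (y :: r)) -> x < y ->
  plactic_congr (y :: r ++ [:: x]) (y :: x :: r).
Proof.
elim: r y => [|z r IH] y /=; first by move=> *; apply: plactic_refl.
move=> /andP[yz sr] xy.
apply: plactic_trans (plactic_cons y (IH z sr (leq_trans xy yz))) _.
apply: (plactic_cat (u := [:: y; z; x]) (u' := [:: y; x; z]) _ (plactic_refl r)).
exact/plactic_knuth/knuth_bca.
Qed.

(** The bumped letter [y] travels left through the smaller entries by repeated use of acb = cab. *)
Lemma plactic_bump_left (x y : 'I_n) r : sorted leq (vals (rcons r x)) -> x < y ->
  plactic_congr (r ++ [:: y; x]) (y :: r ++ [:: x]).
Proof.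
elim: r => [|w r IH] /= sr xy; first exact: plactic_refl.
have sr' := path_sorted sr.
apply: plactic_trans (plactic_cons w (IH sr' xy)) _.
have [z [s [-> wz zy]]] : exists z s, [/\ r ++ [:: x] = z :: s, w <= z & z < y].
  rewrite cats1; case: r {IH sr'} sr => [|z r] /=.
    by rewrite andbT => wx; exists x, [::].
  move=> /andP[wz] /(order_path_min leq_trans) /allP a.
  exists z, (rcons r x); split=> //; apply: leq_ltn_trans xy; apply: a.
  by apply: map_f; rewrite mem_rcons inE eqxx.
apply: (plactic_cat (u := [:: w; y; z]) (u' := [:: y; w; z]) _ (plactic_refl s)).
exact/plactic_sym/plactic_knuth/knuth_cab.
Qed.

Definition row_word t := flatten (rev t).

Lemma row_word_cons r t : row_word (r :: t) = row_word t ++ r.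
Proof. by rewrite /row_word rev_cons -cats1 flatten_cat /= cats0. Qed.

Lemma tab_insert t (x : 'I_n) : is_tab (map (@vals n) t) -> exists t',
  [/\ plactic_congr (row_word t ++ [:: x]) (row_word t'),
      is_tab (map (@vals n) t')
    & head [::] (map (@vals n) t') = row_ins x (head [::] (map (@vals n) t))].
Proof.
elim: t x => [|r t IH] x /=.
  by move=> _; exists [:: [:: x]]; split=> //; apply: plactic_refl.
move=> [sr dr tt].
have fE : find (ltn x) (vals r) = find (fun y : 'I_n => x < y) r.
  by rewrite /vals find_map.
have [hr|hr] := boolP (has (fun y : 'I_n => x < y) r); last first.
  have rx : row_ins x (vals r) = vals (rcons r x).
    rewrite /row_ins fE (hasNfind hr) set_nthE size_map ltnn subnn cats1.
    by rewrite /vals map_rcons.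
  exists (rcons r x :: t); split=> //=.
    by rewrite !row_word_cons -catA cats1; apply: plactic_refl.
  rewrite -rx; split=> //; first exact: row_ins_sorted.
  case: dr => sz lt; rewrite rx; split=> [|p ps].
    by rewrite size_map size_rcons leqW // -(size_map (@nat_of_ord n)).
  by rewrite /vals map_rcons nth_rcons (leq_trans ps sz) lt.
set p := find _ r in fE hr; have pr : p < size r by rewrite -has_find.
set y := nth x r p; set r1 := take p r; set r2 := drop p.+1 r.
have er : r = r1 ++ y :: r2 by rewrite -drop_nth // cat_take_drop.
have ey : nth 0 (vals r) p = y by rewrite (nth_map x).
have xy : x < y := nth_find x hr.
have e : row_ins x (vals r) = vals (r1 ++ x :: r2).
  by rewrite /row_ins fE set_nthE size_map pr /vals map_cat /= map_take map_drop.
have sr1 := @row_ins_sorted x _ sr; rewrite e in sr1.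
have := dom_row_ins dr fE; rewrite size_map ey e => /(_ pr) dr1.
have [t' [tt1 tt2 tt3]] := IH y tt.
exists ((r1 ++ x :: r2) :: t'); split=> //=; last by rewrite tt3.
rewrite !row_word_cons -catA {1}er.
apply: plactic_trans (plactic_cat tt1 (plactic_refl _)).
rewrite -!catA.
apply: (plactic_cat (plactic_refl _)).
rewrite er /vals map_cat in sr; have := sr1; rewrite /vals map_cat.
move=> {}sr1.
(* The word [r1 y r2 x] becomes [r1 y x r2], then [y r1 x r2]. *)
rewrite cat_cons /=; apply: (@plactic_trans _ _ (r1 ++ y :: x :: r2)).
  apply: (plactic_cat (plactic_refl _)); apply: plactic_bump_right => //.
  exact: subseq_sorted leq_trans _ _ (suffix_subseq _ _) sr.
rewrite -[y :: x :: r2]/([:: y; x] ++ r2) -[x :: r2]/([:: x] ++ r2).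
rewrite [X in plactic_congr X]catA catA -cat_cons.
apply: (plactic_cat _ (plactic_refl _)); apply: plactic_bump_left => //.
rewrite /vals map_rcons -cats1; apply: subseq_sorted sr1; first exact: leq_trans.
by rewrite cat_subseq //= eqxx sub0seq.
Qed.

Lemma plactic_tab (w : seq 'I_n) : exists2 t,
  plactic_congr w (row_word t) & is_tab (map (@vals n) t).
Proof.
elim/last_ind: w => [|w x [t wt tt]]; first by exists [::] => //; apply: plactic_refl.
have [t' [tt' tt2 _]] := tab_insert x tt; exists t' => //.
apply: plactic_trans tt'; rewrite -cats1.
exact: plactic_cat wt (plactic_refl _).
Qed.
End Insertion.

(** * Greene invariants of tableaux *)

Definition cnt j (r : seq nat) := count (fun a => a < j) r.

(** The Greene invariant of a tableau; for [k <= j], [reach_tab_lower] and [reach_tab_upper] relate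
    it to the best value of a sequence of states. *)
Fixpoint shape_sum k j (t : seq (seq nat)) :=
  match k, t with
  | k'.+1, r :: t' => cnt j r + shape_sum k' j t'
  | _, _ => 0
  end.

Lemma shape_sumS k j t :
  shape_sum k.+1 j t = shape_sum k j t + cnt j (nth [::] t k).
Proof.
elim: k t => [|k IH] [|r t] //=; first by case: t => [|r' t] /=; rewrite addnC.
by rewrite -addnA -IH; case: t {IH} => /=; lia.
Qed.

(* The state {0, ..., i-1} together with the k-i largest letters below j. *)
Definition extremal k j i x := minn k (maxn (minn x i) (x + k - j)).

Lemma extremal_steps k j i : steps (extremal k j i).
Proof. by move=> x; rewrite /extremal; lia. Qed.

Lemma extremal_le k j i i' : i <= i' -> below (extremal k j i) (extremal k j i').
Proof. by move=> ii' x; rewrite /extremal; lia. Qed.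

Lemma reach_const W P : steps P -> exists v, reach W P P v.
Proof.
move=> sP; elim: W => [|x W [v IH]]; first by exists 0; constructor.
by exists (hit P x + v); apply: reach_cons.
Qed.

(** A single element leaves [i], follows the letters of the row and joins the largest letters below
    [j]. *)
Lemma reach_row k j i r : i < k <= j -> sorted leq r -> all (leq i) r ->
  exists2 v, cnt j r <= v & reach r (extremal k j i.+1) (extremal k j i) v.
Proof.
move=> /andP[ik kj] sr ai.
(* [mix y] consists of 0, ..., i-1, of [y], and of the k-i-1 largest letters below [j] (the k-i
   largest once [y] is among these). *)
pose mix y x := if x <= y then extremal k j i x else extremal k j i.+1 x.
have mix_steps y : i <= y -> steps (mix y).
  move=> iy x; rewrite /mix /extremal.
  by case: (ltngtP x y) => [xy|xy|->]; rewrite ?ltnn; lia.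
have mix_below y z : y <= z -> below (mix z) (mix y).
  by move=> yz x; rewrite /mix /extremal; case: (leqP x y); case: (leqP x z); lia.
have mix_hit y : i <= y -> y < j -> 0 < hit (mix y) y.
  by move=> iy yj; rewrite /hit /mix /extremal leqnn ltnn; lia.
suff [v le rv] : exists2 v, cnt j r <= v & reach r (mix i) (extremal k j i) v.
  exists v => //; apply: reach_sub rv => x.
  by rewrite /mix /extremal; case: ifP; lia.
have {sr ai} : path leq i r.
  by case: r sr ai => //= y r -> /andP[-> _].
have : i <= i by [].
elim: r {2 3 4}i => [|x r IH] y iy /=.
  by exists 0 => //; constructor => z; rewrite /mix /extremal; case: ifP; lia.
move=> /andP[yx pr]; have ix := leq_trans iy yx.
have [v le rv] := IH x ix pr.
exists (hit (mix x) x + v); last by apply: reach_cons; auto.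
by rewrite /cnt /= leq_add //; case: ltnP => // xj; apply: mix_hit.
Qed.

Lemma all_dom i r s : all (leq i) r -> dom r s -> all (leq i.+1) s.
Proof.
move=> /all_nthP ar [sz lt]; apply/(all_nthP 0) => p ps.
by apply: leq_ltn_trans (lt _ ps); apply: ar; apply: leq_trans ps sz.
Qed.

(** Here [t] stands for the rows of a tableau from the [i]-th on. Rows of index at least [k] are
    read first, in a constant state; each later row carries one element up by [reach_row]. *)
Lemma reach_tab_lower k j i t : k <= j -> i <= k -> is_tab t ->
  all (leq i) (head [::] t) ->
  exists2 v, shape_sum (k - i) j t <= v &
    reach (flatten (rev t)) (extremal k j k) (extremal k j i) v.
Proof.
move=> kj; elim: t i => [|r t IH] i ik /=.
  by move=> _ _; exists 0; [case: (k - i)|constructor; apply: extremal_le].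
move=> [sr dr tt] ar.
have [ik'|ki] := ltnP i k; last first.
  have -> : i = k by lia.
  have [v rv] := reach_const (flatten (rev (r :: t))) (extremal_steps k j k).
  by exists v; rewrite ?subnn.
have [v le rv] := IH _ ik' tt (all_dom ar dr).
have ikj : i < k <= j by rewrite ik'.
have [v' le' rv'] := reach_row ikj sr ar.
exists (v + v'); first by rewrite -[k - i]prednK ?subn_gt0 //= -subnS addnC leq_add.
by rewrite rev_cons -cats1 flatten_cat /= cats0; apply: reach_cat rv rv'.
Qed.

Lemma reach_traj W P Q v : reach W P Q v -> exists T : nat -> nat -> nat,
  [/\ forall t, t < size W -> steps (T t),
      forall t, below (T t.+1) (T t),
      forall t, below (T t) P /\ below Q (T t)
    & v = \sum_(t < size W) hit (T t) (nth 0 W t)].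
Proof.
elim=> [{}P {}Q QP|x {}W {}P S {}Q {}v sS SP r [T [sT dT bT ->]]].
  by exists (fun=> Q); split=> [|t|t|]; rewrite ?big_ord0 //; split.
exists (fun t => if t is t'.+1 then T t' else S); split.
- by case=> // t /= /sT.
- by case=> //; case: (bT 0).
- case=> [|t]; split=> //; first by apply: reach_below r.
    by case: (bT t) => + _; apply: below_trans.
  by case: (bT t).
- by rewrite big_ord_recl.
Qed.

Definition col_height j p (t : seq (seq nat)) :=
  count (fun r => (p < size r) && (nth 0 r p < j)) t.

Lemma col_height0 j p r t : is_tab (r :: t) ->
  ~~ ((p < size r) && (nth 0 r p < j)) -> col_height j p (r :: t) = 0.
Proof.
elim: t r => [|s t IH] r /=; first by move=> _ /negbTE ->.
move=> [sr [sz lt] tt] n; rewrite (negbTE n) /=.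
apply: IH => //; apply: contra n => /andP[ps sj].
by rewrite (leq_trans ps sz); apply: ltn_trans (lt _ ps) sj.
Qed.

Lemma cnt_sum j r : cnt j r = \sum_(p < size r) (nth 0 r p < j).
Proof. by rewrite /cnt -sum1_count big_mkcond (big_nth 0) big_mkord. Qed.

Lemma big_ord_pad m n (F : nat -> nat) : m <= n ->
  (forall p, m <= p -> F p = 0) -> \sum_(p < n) F p = \sum_(p < m) F p.
Proof.
move=> mn F0; rewrite (big_ord_widen _ _ mn) [RHS]big_mkcond /=.
by apply: eq_bigr => p _; case: ltnP => // /F0.
Qed.

(** Since columns increase, the letters below [j] fill the top of each column, so the first [k] rows
    can be counted by columns. *)
Lemma col_height_sum k j t : is_tab t ->
  \sum_(p < size (head [::] t)) minn k (col_height j p t) <= shape_sum k j t.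
Proof.
elim: k t => [|k IH] [|r t] tt; rewrite ?big_ord0 //=.
  by rewrite big1 // => p _; rewrite min0n.
have [sr dr tt'] := tt.
apply: leq_trans (leq_add (leqnn _) (IH _ tt')); rewrite cnt_sum.
rewrite -(@big_ord_pad _ (size r) (fun p => minn k (col_height j p t)));
  [|by case: dr|]; last first.
  move=> p; case: t {tt dr IH} tt' => [|s t] tt' sp; first by rewrite minn0.
  by rewrite col_height0 ?minn0 // negb_and -leqNgt sp.
rewrite -big_split /=; apply: leq_sum => p _; rewrite ltn_ord /=.
have [_|rj] := ltnP; first by rewrite /col_height; lia.
suff: col_height j p (r :: t) = 0 by rewrite /= ltn_ord /=; lia.
by apply: col_height0 => //; rewrite ltn_ord -leqNgt.
Qed.

(** Each column is read from the bottom, hence downwards in value, while states move up: every hit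
    uses a new element. The number [k - Q x] counts the elements of the final state that are at
    least [x]. *)
Lemma reach_tab_upper k j t P Q v : is_tab t ->
  reach (flatten (rev t)) P Q v -> (forall x, P x <= k) ->
  (forall x, j <= x -> k <= Q x) ->
  v <= \sum_(p < size (head [::] t))
          minn (k - Q (nth 0 (head [::] t) p)) (col_height j p t).
Proof.
elim: t P Q v => [|r t IH] P Q v; first by move=> _ /reach_nilE[_ ->].
move=> tt; rewrite rev_cons -cats1 flatten_cat /= cats0.
move=> /reach_split[S [v1 [v2 [r1 r2 ->]]]] Pk Qk.
have [sr [sz lt] tt'] := tt.
have SP := reach_below r1; have QS := reach_below r2.
have := IH _ _ _ tt' r1 Pk (fun x jx => leq_trans (Qk x jx) (QS x)).
set s := head [::] t in sz lt *.
have [T [sT _ bT ->]] := reach_traj r2.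
rewrite (big_ord_widen _ (fun p => minn (k - S (nth 0 s p)) (col_height j p t)) sz).
rewrite big_mkcond /= => le1.
apply: leq_trans (leq_add le1 (leqnn _)) _; rewrite -big_split /=.
apply: leq_sum => p _; rewrite ltn_ord /=.
have := sT p (ltn_ord p) (nth 0 r p); have [TS QT] := bT p.
have Tk x : T p x <= k := leq_trans (leq_trans (TS x) (SP x)) (Pk x).
have Qr := QT (nth 0 r p); have Tr := Tk (nth 0 r p).+1.
have h j' : j <= j' -> T p j' = k.
  by move=> jj; have := Qk _ jj; have := QT j'; have := Tk j'; lia.
have hj : hit (T p) (nth 0 r p) <= (nth 0 r p < j).
  have [_|rj] := ltnP; first exact/hit01/sT.
  by rewrite /hit !h ?leqW // subnn.
move: hj; rewrite /hit.
case: ifP => [ps|_]; last by rewrite /col_height; lia.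
have := steps_le (sT p (ltn_ord p)) (lt _ ps).
have := TS (nth 0 s p); rewrite /col_height; lia.
Qed.

(** Every [k]-subset of {0, ..., j-1} lies between the two end states, which therefore put no
    constraint on the family. *)
Definition greene_le k j U U' :=
  forall v, reach U (extremal k j k) (extremal k j 0) v ->
  exists2 v', v <= v' & reach U' (extremal k j k) (extremal k j 0) v'.

Lemma tab_greene_le k j t t' : k <= j -> is_tab t -> is_tab t' ->
  greene_le k j (flatten (rev t)) (flatten (rev t')) ->
  shape_sum k j t <= shape_sum k j t'.
Proof.
move=> kj tt tt' g.
have a0 : all (leq 0) (head [::] t) by apply/allP.
have [v le /g[v' le' r]] := reach_tab_lower kj (leq0n k) tt a0.
rewrite subn0 in le; apply: leq_trans le (leq_trans le' _).
have Pk x : extremal k j k x <= k by rewrite /extremal geq_minl.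
have Qk x : j <= x -> k <= extremal k j 0 x by rewrite /extremal; lia.
apply: leq_trans (reach_tab_upper tt' r Pk Qk) _.
apply: leq_trans (col_height_sum k j tt'); apply: leq_sum => p _; lia.
Qed.

Lemma tab_nth_row t i : is_tab t ->
  sorted leq (nth [::] t i) /\ all (leq i) (nth [::] t i).
Proof.
have gen m : is_tab t -> all (leq m) (head [::] t) ->
    sorted leq (nth [::] t i) /\ all (leq (m + i)) (nth [::] t i).
  elim: t i m => [|r t IH] i m; first by rewrite nth_nil.
  move=> [sr dr tt] ar; case: i => [|i] /=; first by rewrite addn0.
  by rewrite -addSnnS; apply: IH => //; apply: all_dom dr.
by move=> tt; apply: (gen 0) => //; apply/allP.
Qed.

Lemma sorted_cnt_eq r s : sorted leq r -> sorted leq s ->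
  (forall j, cnt j r = cnt j s) -> r = s.
Proof.
move=> sr ss e; apply: (sorted_eq leq_trans anti_leq sr ss).
apply/allP => x _ /=.
have c u : count_mem x u + cnt x u = cnt x.+1 u.
  by elim: u => //= y u; rewrite /cnt /=; lia.
by rewrite -(eqn_add2r (cnt x r)) {2}e !c e.
Qed.

Lemma flatten_rev_eq (T : Type) (t t' : seq (seq T)) :
  (forall i, nth [::] t i = nth [::] t' i) -> flatten (rev t) = flatten (rev t').
Proof.
have fl r (s : seq (seq T)) : flatten (rev (r :: s)) = flatten (rev s) ++ r.
  by rewrite rev_cons -cats1 flatten_cat /= cats0.
have nil (s : seq (seq T)) : (forall i, nth [::] s i = [::]) -> flatten (rev s) = [::].
  elim: s => // r s IH h; have /= r0 := h 0.
  by rewrite fl r0 IH // => i; apply: (h i.+1).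
elim: t t' => [|r t IH] [|r' t'] h //.
- by rewrite [RHS]nil // => i; rewrite -h nth_nil.
- by rewrite [LHS]nil // => i; rewrite h nth_nil.
- by have /= rr := h 0; rewrite !fl rr (IH t') // => i; apply: (h i.+1).
Qed.

(** Differences in [k] give the content of each row. The range [k <= j] suffices, as row [i] only
    has letters at least [i]. *)
Lemma tab_eq n t t' : is_tab t -> is_tab t' ->
  all (gtn n) (flatten t) -> all (gtn n) (flatten t') ->
  (forall k j, k <= j <= n -> shape_sum k j t = shape_sum k j t') ->
  flatten (rev t) = flatten (rev t').
Proof.
move=> tt tt' tn tn' e; apply: flatten_rev_eq => i.
have [si ai] := tab_nth_row i tt; have [si' ai'] := tab_nth_row i tt'.
have rown s : all (gtn n) (flatten s) -> all (gtn n) (nth [::] s i).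
  elim: s i {si ai si' ai'} => [|r s IH] [|i] //=; rewrite all_cat => /andP[] //.
  by move=> _; apply: IH.
have cntn r j : all (gtn n) r -> cnt j r = cnt (minn j n) r.
  by move=> /allP rn; apply: eq_in_count => a /rn /= an; rewrite leq_min an andbT.
apply: sorted_cnt_eq => // j; rewrite cntn ?rown // [RHS]cntn ?rown //.
have : minn j n <= n := geq_minr _ _; move: (minn j n) => {}j jn.
have [ij|ji] := ltnP i j.
  have := e i.+1 j; rewrite ij jn !shape_sumS (e i j) ?(ltnW ij) // => /(_ isT).
  exact: addnI.
have z r : all (leq i) r -> cnt j r = 0.
  move=> ar; apply/eqP; rewrite eqn0Ngt -has_count -all_predC.
  by apply: sub_all ar => a /=; lia.
by rewrite !z.
Qed.

(** Both words are replaced by congruent tableaux; domination transports the invariants, and these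
    determine the reading word of a tableau. *)
Lemma greene_plactic n (u v : seq 'I_n) :
  (forall k j, k <= j <= n -> greene_le k j (vals u) (vals v)) ->
  (forall k j, k <= j <= n -> greene_le k j (vals v) (vals u)) ->
  plactic_congr u v.
Proof.
move=> uv vu; have [t ut tt] := plactic_tab u; have [t' vt tt'] := plactic_tab v.
have vE (s : seq (seq 'I_n)) :
    vals (row_word s) = flatten (rev (map (@vals n) s)).
  by rewrite /row_word /vals map_flatten map_rev.
have [du du'] := plactic_dominated ut; have [dv dv'] := plactic_dominated vt.
rewrite !vE in du du' dv dv'.
have g U U' W W' k j : dominated U' U -> dominated W W' ->
    greene_le k j U W -> greene_le k j U' W'.
  move=> dU dW UW x /dU[x1 le1 /UW[x2 le2 /dW[x3 le3 r]]].
  by exists x3 => //; apply: leq_trans le1 (leq_trans le2 le3).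
have e : flatten (rev (map (@vals n) t)) = flatten (rev (map (@vals n) t')).
  have small (s : seq (seq 'I_n)) : all (gtn n) (flatten (map (@vals n) s)).
    by rewrite -map_flatten; apply/allP => _ /mapP[x _ ->] /=.
  apply: (@tab_eq n) => // k j kjn; apply/eqP; rewrite eqn_leq.
  have [kj _] := andP kjn.
  apply/andP; split; apply: tab_greene_le => //.
    exact: g du' dv (uv k j kjn).
  exact: g dv' du (vu k j kjn).
rewrite -!vE in e; have {}e := inj_map (@ord_inj n) e.
by apply: plactic_trans ut _; rewrite e; apply: plactic_sym.
Qed.

(** * Compressing one level *)

Definition rich n (R : seq bool) := forall y, size y <= n.-1 ->
  exists2 p, p + size y <= size R &
    forall i, i < size y -> nth true R (p + i) = nth true y i.

(* The slots in [used] before a free copy [r] of [R] stay where they are, the later ones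
   (at most [n.-1], since 0 stays) are compressed to a factor of that copy. *)
Lemma retime n z (lab : nat -> bool) (R : seq bool) (used : seq nat) :
  rich n R -> 0 < size R -> 0 \in used -> size used <= n ->
  (forall r i, z <= r <= z + n -> i < size R ->
    lab (r * size R + i) = nth true R i) ->
  exists mu r, [/\ z <= r <= z + n, mu 0 = 0,
    forall s, s \in used -> lab (mu s) = lab s,
    forall s, s \in used -> mu s <= s /\
      (mu s = s /\ s < r * size R \/ r * size R <= mu s < r.+1 * size R)
    & forall s1 s2, s1 \in used -> s2 \in used -> s1 < s2 ->
        mu s1 < mu s2 /\ mu s2 + s1 <= mu s1 + s2].
Proof.
set B := size R => richR B0 u0 szu copies.
(* Pigeonhole: the zone has n+1 copies and at most [n] slots are used, so some copy [r] contains no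
   used slot. *)
have /hasP[r] : has (fun r => r \notin map (divn^~ B) used) (iota z n.+1).
  rewrite -[has _ _]negbK -all_predC; apply/negP => /allP a.
  have := uniq_leq_size (iota_uniq z n.+1) (s2 := map (divn^~ B) used).
  rewrite size_iota size_map => h; suff: n < n by rewrite ltnn.
  by apply: leq_trans szu; apply: h => r /a /=; rewrite negbK.
rewrite mem_iota addnS ltnS => zr rN.
have r0 : 0 < r.
  by rewrite lt0n; apply: contraNneq rN => ->; apply/mapP; exists 0; rewrite ?div0n.
have free s : s \in used -> s < r * B \/ r.+1 * B <= s.
  move=> su; case: (ltnP s (r * B)) => [|rs]; first by left.
  right; rewrite leqNgt; apply: contra rN => sr; apply/mapP; exists s => //.
  by apply/eqP; rewrite eq_sym eqn_leq leq_divRL // rs andbT -ltnS ltn_divLR.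
(* The used slots from copy [r] on; slot 0 is used and lies before them, which leaves at most
   [n.-1]. *)
pose late m := [seq s <- iota (r * B) m | s \in used].
have late_size m : size (late m) <= n.-1.
  have : size (0 :: late m) <= size used.
    apply: uniq_leq_size => [|s].
      rewrite /= filter_uniq ?iota_uniq // andbT mem_filter mem_iota.
      by rewrite leqNgt muln_gt0 r0 B0 andbF.
    by rewrite inE mem_filter => /orP[/eqP->|/andP[]].
  rewrite /=; lia.
pose M := (\max_(s <- used) s).+1.
have usedM s : s \in used -> s < M by move=> su; rewrite ltnS leq_bigmax_seq.
pose y := map lab (late M).
have szy : size y <= n.-1 by rewrite size_map.
have [p pB yP] := richR y szy.
pose rank s := count (mem used) (iota (r * B) (s - r * B)).
have rankE s : size (late (s - r * B)) = rank s by rewrite size_filter.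
have late_cat s m : r * B <= s -> s + m <= r * B + M -> late M =
    late (s - r * B) ++ [seq x <- iota s m | x \in used] ++
    [seq x <- iota (s + m) (r * B + M - (s + m)) | x \in used].
  move=> rs smM; rewrite -!filter_cat; congr filter.
  have -> : M = (s - r * B) + (m + (r * B + M - (s + m))) by lia.
  by rewrite !iotaD subnKC //; congr (_ ++ (_ ++ iota _ _)); lia.
have rankP s : s \in used -> r * B <= s ->
    rank s < size y /\ nth true y (rank s) = lab s.
  move=> su rs; have sM := usedM s su.
  have := late_cat s 1 rs ltac:(lia); rewrite /= su /= => lE.
  have rl : rank s < size (late M) by rewrite lE size_cat /= rankE; lia.
  rewrite size_map; split=> //; rewrite (nth_map 0) //.
  by rewrite lE nth_cat rankE ltnn subnn.
have rankD s1 s2 : r * B <= s1 -> s1 <= s2 ->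
    rank s2 = rank s1 + count (mem used) (iota s1 (s2 - s1)).
  move=> rs1 s12; rewrite /rank.
  have -> : s2 - r * B = (s1 - r * B) + (s2 - s1) by lia.
  by rewrite iotaD count_cat subnKC.
(* Late slots go, in order, to the consecutive positions of the factor of copy [r] that spells their
   labels [y]. *)
pose mu s := if s < r * B then s else r * B + p + rank s.
have muE s : s \in used -> r.+1 * B <= s ->
    [/\ r * B <= s, mu s = r * B + p + rank s, rank s < size y & p + rank s < B].
  move=> su rs; have rs' : r * B <= s by move: rs; rewrite mulSn; lia.
  have [rk _] := rankP s su rs'.
  by split=> //; [rewrite /mu ltnNge rs'|lia].
exists mu, r; split=> //.
- by rewrite /mu muln_gt0 r0 B0.
- move=> s su; case: (free s su) => [sr|rs]; first by rewrite /mu sr.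
  have [rs' -> rk pk] := muE s su rs; have [_ <-] := rankP s su rs'.
  by rewrite -addnA copies ?yP.
- move=> s su; case: (free s su) => [sr|rs]; first by rewrite /mu sr; split=> //; left.
  have [rs' -> rk pk] := muE s su rs; rewrite mulSn in rs *.
  by split; [lia|right; lia].
- move=> s1 s2 u1 u2 s12.
  case: (free s1 u1) => [sr1|rs1]; case: (free s2 u2) => [sr2|rs2].
  + by rewrite /mu sr1 sr2; lia.
  + have [rs' -> rk pk] := muE s2 u2 rs2; rewrite /mu sr1 mulSn in rs2 *; lia.
  + by move: rs1; rewrite mulSn; lia.
  + have [rs1' -> rk1 pk1] := muE s1 u1 rs1; have [rs2' -> rk2 pk2] := muE s2 u2 rs2.
    rewrite (rankD s1 s2) //; last exact: ltnW.
    have : count (mem used) (iota s1 (s2 - s1)) <= s2 - s1.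
      by rewrite -[X in _ <= X](size_iota s1); apply: count_size.
    have : 0 < count (mem used) (iota s1 (s2 - s1)).
      rewrite -has_count; apply/hasP; exists s1 => //; rewrite mem_iota; lia.
    lia.
Qed.

Lemma nonincreasing_count (p : nat -> bool) L t :
  (forall t, p t.+1 -> p t) -> t < L -> p t = (t < count p (iota 0 L)).
Proof.
move=> dp tL; have dpk s d : p (s + d) -> p s.
  by elim: d => [|d IH]; rewrite ?addn0 // addnS => /dp.
have -> : L = t + (L - t) by lia.
rewrite iotaD count_cat add0n; case pt : (p t).
  have -> : L - t = (L - t).-1.+1 by lia.
  have -> : count p (iota 0 t) = size (iota 0 t).
    apply/eqP; rewrite -all_count; apply/allP => s; rewrite mem_iota => /andP[_ st].
    by apply: (dpk s (t - s)); rewrite subnKC // ltnW.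
  by rewrite size_iota /= pt; lia.
have -> : count p (iota t (L - t)) = 0.
  apply/eqP; rewrite eqn0Ngt -has_count; apply/negP => /hasP[s].
  by rewrite mem_iota => /andP[ts _]; rewrite -(subnKC ts) => /dpk; rewrite pt.
by have := count_size p (iota 0 t); rewrite size_iota; lia.
Qed.

Lemma count_take_sum (a : nat) W m :
  count_mem a (take m W) = \sum_(t < size W) ((nth 0 W t == a) && (t < m)).
Proof.
elim: W m => [|x W IH] [|m] /=; rewrite ?big_ord0 //.
  by rewrite big1 // => t _; rewrite andbF.
by rewrite big_ord_recl /= andbT IH.
Qed.

Lemma sum_lt_ord n m : m <= n -> \sum_(l < n) (l < m) = m.
Proof.
elim: n m => [|n IH] m; first by rewrite big_ord0; case: m.
rewrite big_ord_recl; case: m => [|m] mn /=; first by rewrite big1.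
by rewrite IH.
Qed.

(** Term [l.+1] on the left is matched with term [l] on the right; only term 0 is left over. *)
Lemma sum_shift n (p q : nat -> bool) :
  (forall l, l.+1 < n -> p l.+1 -> q l) ->
  \sum_(l < n) p l <= (\sum_(l < n) q l).+1.
Proof.
case: n => [|n] pq; first by rewrite !big_ord0.
rewrite big_ord_recl big_ord_recr /= -add1n leq_add ?leq_b1 //.
apply: leq_trans (leq_addr _ _); apply: leq_sum => l _; rewrite /bump /= add1n.
by case: (boolP (p _)) => // /pq ->; rewrite // ltnS ltn_ord.
Qed.

(** * Gains along the image of a word under a substitution *)

Definition subst_word (T : Type) (phi : bool -> seq T) (u : seq bool) :=
  flatten (map phi u).

Lemma subst_word_cat (T : Type) (phi : bool -> seq T) u v :
  subst_word phi (u ++ v) = subst_word phi u ++ subst_word phi v.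
Proof. by rewrite /subst_word map_cat flatten_cat. Qed.

Section Expansion.
Variables (phi : bool -> seq nat) (K : nat) (c : nat -> nat).
Hypotheses (size_phi : forall b, size (phi b) = K)
  (count_phi : forall b a, count_mem a (phi b) = c a).

Lemma size_subst_word u : size (subst_word phi u) = size u * K.
Proof. by elim: u => //= b u IH; rewrite size_cat IH size_phi mulSn. Qed.

Lemma count_take_subst_word a u s o : s <= size u -> o <= K ->
  s * K + o <= size u * K ->
  count_mem a (take (s * K + o) (subst_word phi u)) =
  s * c a + count_mem a (take o (phi (nth true u s))).
Proof.
elim: u s => [|b u IH] [|s] //=.
- by move=> _ _; rewrite !mul0n !add0n leqn0 => /eqP ->; rewrite take0.
- by move=> _ oK _; rewrite !mul0n !add0n takel_cat ?size_phi.
rewrite ltnS => su oK h; rewrite mulSn -addnA take_cat size_phi ltnNge leq_addr /=.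
rewrite addKn count_cat count_phi IH //; first by rewrite mulSn addnA.
by rewrite !mulSn in h *; lia.
Qed.

Local Open Scope ring_scope.

(* The number of hits on [W] when [h] is added to a fixed state, relative to that state. *)
Definition gain (h : nat -> nat -> nat) (W : seq nat) : int :=
  \sum_(t < size W) ((h t (nth 0%N W t).+1)%:Z - (h t (nth 0%N W t))%:Z).

(** The sums over times and levels are exchanged. Level [l] contributes the occurrences of each [a]
    before [tau l a.+1] minus those before [tau l a], independently of the other levels. *)
Lemma gain_levels n j (tau : nat -> nat -> nat) (h : nat -> nat -> nat)
    (W : seq nat) :
  (forall l x, (l < n)%N -> (j <= x)%N -> tau l x = 0%N) ->
  (forall t x, (t < size W)%N -> h t x = (\sum_(l < n) (t < tau l x))%N) ->
  gain h W = \sum_(l < n) \sum_(a < j)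
    ((count_mem (a : nat) (take (tau l a.+1) W))%:Z
      - (count_mem (a : nat) (take (tau l a) W))%:Z).
Proof.
move=> tau0 hE; rewrite /gain.
under eq_bigr => t _ do rewrite !hE // -!natz !natr_sum -sumrB.
rewrite exchange_big /=; apply: eq_bigr => l _.
under [RHS]eq_bigr => a _ do
  rewrite !count_take_sum -!natz !natr_sum -sumrB.
rewrite exchange_big /=; apply: eq_bigr => t _.
set x := nth 0%N W t.
have [xj|jx] := ltnP x j.
  rewrite (bigD1 (Ordinal xj)) //= eqxx big1 ?addr0 // => a.
  rewrite -val_eqE /= eq_sym => /negbTE -> /=; exact: subrr.
rewrite !tau0 ?leqW // subrr big1 // => a _.
have -> : (x == a) = false by have := ltn_ord a; lia.
exact: subrr.
Qed.

(** Labels and offsets are kept, so only the number of complete slots matters, each containing [c a]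
    letters [a]. The change is a sum of products of [c a - theta] and [d a.+1 - d a], each of the
    right sign. *)
Lemma retime_gain (j : nat) (D : pred nat) (eps theta : int) u
    (s s' o : nat -> nat) :
  (forall a, (a < j)%N -> if D a then eps * ((c a)%:Z - theta) <= 0
                          else 0 <= eps * ((c a)%:Z - theta)) ->
  (forall a, if D a then (s' a.+1 + s a <= s' a + s a.+1)%N
             else (s' a + s a.+1 <= s' a.+1 + s a)%N) ->
  (forall x, nth true u (s' x) = nth true u (s x)) ->
  (forall x, [/\ s x <= size u, s' x <= size u, o x <= K,
                s x * K + o x <= size u * K & s' x * K + o x <= size u * K]%N) ->
  s 0%N = s' 0%N -> s j = s' j ->
  eps * (\sum_(a < j)
    ((count_mem (a : nat) (take (s a.+1 * K + o a.+1) (subst_word phi u)))%:Z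
      - (count_mem (a : nat) (take (s a * K + o a) (subst_word phi u)))%:Z))
  <= eps * (\sum_(a < j)
    ((count_mem (a : nat) (take (s' a.+1 * K + o a.+1) (subst_word phi u)))%:Z
      - (count_mem (a : nat) (take (s' a * K + o a) (subst_word phi u)))%:Z)).
Proof.
move=> sgn mono lab bnd e0 ej; rewrite -subr_ge0 -mulrBr -sumrB.
pose d x : int := (s' x)%:Z - (s x)%:Z.
have -> : \sum_(a < j)
    ((count_mem (a : nat) (take (s' a.+1 * K + o a.+1) (subst_word phi u)))%:Z
      - (count_mem (a : nat) (take (s' a * K + o a) (subst_word phi u)))%:Z
    - ((count_mem (a : nat) (take (s a.+1 * K + o a.+1) (subst_word phi u)))%:Z
      - (count_mem (a : nat) (take (s a * K + o a) (subst_word phi u)))%:Z))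
    = \sum_(a < j) (((c a)%:Z - theta) * (d a.+1 - d a)).
  (* Subtracting [theta] changes nothing, since the increments of [d] telescope to 0. *)
  have -> : \sum_(a < j) (((c a)%:Z - theta) * (d a.+1 - d a)) =
     \sum_(a < j) ((c a)%:Z * (d a.+1 - d a)).
    under eq_bigr => a _ do rewrite mulrBl.
    rewrite sumrB -mulr_sumr (_ : \sum_(a < j) (d a.+1 - d a) = 0) ?mulr0 ?subr0 //.
    rewrite -(big_mkord xpredT (fun a => d a.+1 - d a)) telescope_sumr //.
    by rewrite /d e0 ej !subrr.
  apply: eq_bigr => a _.
  have [? ? ? ? ?] := bnd a; have [? ? ? ? ?] := bnd a.+1.
  by rewrite !count_take_subst_word // !lab /d; lia.
rewrite mulr_sumr; apply: sumr_ge0 => a _; rewrite mulrA.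
have := sgn a (ltn_ord a); have := mono a; rewrite /d; case: (D a) => m sg.
  by apply: mulr_le0 => //; lia.
by apply: mulr_ge0 => //; lia.
Qed.

End Expansion.

(* The possible height functions of a state over one whose complement (for states below
   it) or whose set of letters (for states above it, in reversed time) is [D]. *)
Definition admissible j (D : pred nat) (h : nat -> nat -> nat) :=
  [/\ forall t x, h t.+1 x <= h t x, forall t, h t 0 = 0,
      forall t x, j <= x -> h t x = 0
    & forall t a, if D a then h t a <= h t a.+1 <= (h t a).+1
                  else h t a.+1 <= h t a <= (h t a.+1).+1].

Lemma nth_copies (T : Type) (x0 : T) N (R : seq T) rest r i :
  r < N -> i < size R ->
  nth x0 (flatten (nseq N R) ++ rest) (r * size R + i) = nth x0 R i.
Proof.
move=> rN iR; elim: N r rN => // N IH [|r] rN /=.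
  by rewrite -catA nth_cat iR.
rewrite -catA nth_cat mulSn -addnA ltnNge leq_addr /= addKn; exact: IH.
Qed.

Lemma size_copies (T : Type) N (R : seq T) : size (flatten (nseq N R)) = N * size R.
Proof. by elim: N => //= N IH; rewrite size_cat IH mulSn. Qed.

Section Straighten.
Variables (phi : bool -> seq nat) (K : nat) (c : nat -> nat).
Hypotheses (size_phi : forall b, size (phi b) = K)
  (count_phi : forall b (a : nat), count_mem a (phi b) = c a).
Variables (n j : nat) (R rest : seq bool).
Hypotheses (n0 : 0 < n) (jn : j <= n) (richR : rich n R) (R0 : 0 < size R).

Let w := flatten (nseq (n * n.+1) R).
Let u := w ++ rest.

(* [tau l x] is the time at which the [l]-th level set of [h] loses [x]. It lies in slot
   [sl l x], at offset [o l x]; level [l] is retimed slotwise by [mu l], inside the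
   [l]-th last zone of [n.+1] copies of [R], which keeps the levels in order. *)
Lemma straighten (D : pred nat) (eps theta : int) h :
  (forall a, (a < j)%N -> if D a then (eps * ((c a)%:Z - theta) <= 0)%R
                          else (0 <= eps * ((c a)%:Z - theta))%R) ->
  admissible j D h -> exists h', [/\ admissible j D h',
    forall t x, size w * K <= t -> h' t x = 0
    & (eps * gain h (subst_word phi u) <= eps * gain h' (subst_word phi u))%R].
Proof.
move=> sgn [h_t h0 hj hD]; set W := subst_word phi u.
have sW : size W = size u * K by apply: size_subst_word.
have [K0|K0] := posnP K.
  exists (fun _ _ => 0); split=> //.
    by split=> // t a; case: (D a).
  by rewrite /gain sW K0 muln0 !big_ord0.
have hx t x : h t x <= x.
  elim: x => [|x IH]; first by rewrite h0.
  by have := hD t x; case: (D x); lia.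
have hn t x : h t x <= n.
  by have [jx|xj] := leqP j x; [rewrite hj|have := hx t x; lia].
pose tau l x := count (fun t => l < h t x) (iota 0 (size W)).
have tauP l x t : t < size W -> (t < tau l x) = (l < h t x).
  move=> tW; rewrite -(nonincreasing_count (p := fun t => l < h t x)) //.
  by move=> s lt; apply: leq_trans lt (h_t _ _).
have tau_le l l' x y : (forall t, l < h t x -> l' < h t y) -> tau l x <= tau l' y.
  by move=> le; apply: sub_count.
have tau_W l x : tau l x <= size W.
  by rewrite -[X in _ <= X](size_iota 0); apply: count_size.
have tau0 l x : (forall t, h t x = 0) -> tau l x = 0.
  by move=> z; apply/eqP; rewrite eqn0Ngt -has_count -all_predC;
    apply/allP => t _ /=; rewrite z.
pose sl l x := tau l x %/ K; pose o l x := tau l x %% K.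
have tauE l x : tau l x = sl l x * K + o l x := divn_eq _ _.
have oK l x : o l x < K by rewrite ltn_mod.
(* Heights vanish at 0 and from [j] on, so slot 0 and the slots of 0 < x < j are all that occur: at
   most [n] slots. *)
pose used l := 0 :: [seq sl l x | x <- iota 1 j.-1].
have size_used l : size (used l) <= n by rewrite /= size_map size_iota; lia.
have sl0 l x : (forall t, h t x = 0) -> sl l x = 0.
  by move=> z; rewrite /sl tau0 // div0n.
have sl_used l x : sl l x \in used l.
  rewrite inE; have [x0|xN0] := eqVneq x 0; first by rewrite sl0 // x0.
  have [jx|xj] := leqP j x; first by rewrite sl0 // => t; apply: hj.
  by rewrite map_f ?orbT // mem_iota; lia.
(* Higher levels get earlier zones, in keeping with heights that decrease in time. *)
pose zone l := (n - l.+1) * n.+1.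
have zone_N l r : l < n -> r <= zone l + n -> r < n * n.+1.
  move=> ln rz; have : (n - l.+1).+1 * n.+1 <= n * n.+1 by rewrite leq_mul2r; lia.
  by rewrite mulSn; rewrite /zone in rz; lia.
have /choice[f fP] l : exists mr : (nat -> nat) * nat, l < n ->
    [/\ zone l <= mr.2 <= zone l + n, mr.1 0 = 0,
    forall s, s \in used l -> nth true u (mr.1 s) = nth true u s,
    forall s, s \in used l -> mr.1 s <= s /\
      (mr.1 s = s /\ s < mr.2 * size R \/
       mr.2 * size R <= mr.1 s < mr.2.+1 * size R)
    & forall s1 s2, s1 \in used l -> s2 \in used l -> s1 < s2 ->
        mr.1 s1 < mr.1 s2 /\ mr.1 s2 + s1 <= mr.1 s1 + s2].
  have [nl|ln] := leqP n l; first by exists (id, 0).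
  have [mu [r H]] := @retime n (zone l) (nth true u) R (used l) richR R0
    (mem_head _ _) (size_used l) (fun r i zr => @nth_copies _ true _ R rest r i
      (zone_N l r ln (proj2 (andP zr)))).
  by exists (mu, r).
pose mu l := (f l).1; pose r l := (f l).2.
pose s' l x := mu l (sl l x).
pose tau' l x := s' l x * K + o l x.
pose h' t x := \sum_(l < n) (t < tau' l x).
have s'0 l x : l < n -> (forall t, h t x = 0) -> s' l x = 0.
  by move=> ln z; rewrite /s' /mu sl0 //; have [_ ->] := fP l ln.
have tau'0 l x : l < n -> (forall t, h t x = 0) -> tau' l x = 0.
  by move=> ln z; rewrite /tau' s'0 // /o tau0 // mod0n.
have tau'_le l x : l < n -> tau' l x <= tau l x.
  move=> ln; have [_ _ _ /(_ _ (sl_used l x))[le _] _] := fP l ln.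
  by rewrite tauE /tau' leq_add2r leq_mul2r le orbT.
have tau'_same l x y : l < n -> tau l x <= tau l y -> tau' l x <= tau' l y.
  move=> ln; rewrite !tauE /tau' => le.
  have [_ _ _ _ /(_ _ _ (sl_used l x) (sl_used l y)) lip] := fP l ln.
  have := oK l x; have := oK l y.
  have [lt|lt|eq] := ltngtP (sl l x) (sl l y).
  - have [+ _] := lip lt; rewrite -/(mu l) -/(s' l x) -/(s' l y) => lt' _ ox.
    have : (s' l x).+1 * K <= s' l y * K by rewrite leq_mul2r lt' orbT.
    by rewrite mulSn; lia.
  - have : (sl l y).+1 * K <= sl l x * K by rewrite leq_mul2r lt orbT.
    by rewrite mulSn; lia.
  - by move: le; rewrite /s' eq !leq_add2l.
(* Either the slot of level [l] is unmoved, and level [l.+1] only moves earlier; or it lies in copy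
   [r l], and level [l.+1] is over by the end of the earlier copy [r l.+1]. *)
have tau'_next l x y : l.+1 < n -> tau l.+1 x <= tau l y ->
    tau' l.+1 x <= tau' l y.
  move=> ln le; have ln' := ltnW ln.
  have [zr1 _ _ /(_ _ (sl_used l.+1 x))[_ kx] _] := fP _ ln.
  have [zr2 _ _ /(_ _ (sl_used l y))[_ ky] _] := fP _ ln'.
  case: ky => [[ky _]|/andP[ky _]].
    by rewrite {2}/tau' /s' /mu ky -tauE; apply: leq_trans (tau'_le _ _ ln) le.
  have rr : (r l.+1).+1 <= r l.
    have zE : zone l = zone l.+1 + n.+1.
      have -> : zone l.+1 + n.+1 = (n - l.+2).+1 * n.+1 by rewrite mulSn addnC.
      by rewrite /zone; congr (_ * _); lia.
    by rewrite /r; lia.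
  have lt : s' l.+1 x < (r l.+1).+1 * size R.
    by case: kx => [[kx]|/andP[] //]; rewrite -/(r _) /s' /mu kx mulSn; lia.
  have lt' : s' l.+1 x < s' l y.
    apply: leq_trans lt _; apply: leq_trans ky.
    by rewrite leq_mul2r rr orbT.
  have : (s' l.+1 x).+1 * K <= s' l y * K by rewrite leq_mul2r lt' orbT.
  by have := oK l.+1 x; rewrite mulSn /tau'; lia.
have nE : n = n.-1.+1 by rewrite prednK.
exists h'; split.
- split.
  + by move=> t x; apply: leq_sum => l _; lia.
  + by move=> t; apply: big1 => l _; rewrite tau'0.
  + by move=> t x jx; apply: big1 => l _; rewrite tau'0 // => t'; apply: hj.
  + move=> t a.
    (* A height difference of at most one amounts to comparing level [l.+1] at [x] with level [l] at
       [y]. *)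
    have shift x y : (forall t, h t x <= (h t y).+1) -> h' t x <= (h' t y).+1.
      move=> le; apply: (@sum_shift n (fun l => t < tau' l x)
                                      (fun l => t < tau' l y)) => l ln lt.
      apply: leq_trans lt _; apply: tau'_next => //.
      by apply: tau_le => t' lt'; have := le t'; lia.
    have same x y : (forall t, h t x <= h t y) -> h' t x <= h' t y.
      move=> le; apply: leq_sum => l _.
      have lexy : tau' l x <= tau' l y.
        by apply: tau'_same => //; apply: tau_le => t' lt; apply: leq_trans (le t').
      by case: (ltnP t (tau' l x)) => // lt; rewrite (leq_trans lt lexy).
    case Da : (D a); apply/andP; split;
      [apply: same|apply: shift|apply: same|apply: shift];
      by move=> t'; have := hD t' a; rewrite Da => /andP[].
- move=> t x wt; apply: big1 => l _.
  have [zr _ _ /(_ _ (sl_used l x))[_ kx] _] := fP _ (ltn_ord l).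
  have rN : (r l).+1 * size R <= size w.
    rewrite size_copies leq_mul2r; apply/orP; right.
    by apply: zone_N (ltn_ord l) _; case/andP: zr.
  have sw : s' l x < size w.
    apply: leq_trans rN; move: kx; rewrite -/(r l) /s' /mu mulSn; lia.
  have : (s' l x).+1 * K <= size w * K by rewrite leq_mul2r sw orbT.
  by have := oK l x; rewrite mulSn /tau'; lia.
- rewrite (@gain_levels n j tau) //; first last.
  + move=> t x tW; rewrite -[LHS](@sum_lt_ord n) //.
    by apply: eq_bigr => l _; rewrite tauP.
  + by move=> l x _ jx; apply: tau0 => t; apply: hj.
  rewrite (@gain_levels n j tau') //; last first.
    by move=> l x ln jx; apply: tau'0 => // t; apply: hj.
  rewrite !mulr_sumr; apply: ler_sum => l _; have ln := ltn_ord l.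
  under eq_bigr => a _ do rewrite !tauE.
  apply: (@retime_gain phi K c size_phi count_phi j D eps theta u) => //.
  + have [_ _ _ _ lip] := fP _ ln.
    have slip x y : tau l x <= tau l y -> s' l y + sl l x <= s' l x + sl l y.
      move=> /(leq_div2r K); rewrite -/(sl l x) -/(sl l y) leq_eqVlt => /orP[/eqP e|lt].
        by rewrite /s' e addnC.
      by have [] := lip _ _ (sl_used l x) (sl_used l y) lt.
    move=> a; have := hD ^~ a; case: (D a) => hDa.
      by apply: slip; apply: tau_le => t lt; have := hDa t; lia.
    by apply: slip; apply: tau_le => t lt; have := hDa t; lia.
  + by move=> x; have [_ _ lab _ _] := fP _ ln; apply: lab.
  + move=> x; have su : sl l x <= size u.
      by rewrite /sl -[X in _ <= X](mulnK _ K0) -sW leq_div2r.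
    split=> //; last 2 first.
    * by rewrite -tauE -sW.
    * by rewrite -/(tau' l x) -sW; apply: leq_trans (tau'_le _ _ ln) _.
    * have [_ _ _ /(_ _ (sl_used l x))[le _] _] := fP _ ln.
      exact: leq_trans le su.
    * exact: ltnW.
  + by rewrite sl0 // s'0.
  + by rewrite sl0 ?s'0 // => t; apply: hj.
Qed.
End Straighten.

(** * Staying in the best state *)

Lemma top_letters (c : nat -> nat) k j : k <= j ->
  exists (D : pred nat) (theta : int), [/\ count D (iota 0 j) = k,
    forall a, j <= a -> ~~ D a,
    forall a, a < j -> D a -> (theta <= (c a)%:Z)%R
    & forall a, a < j -> ~~ D a -> ((c a)%:Z <= theta)%R].
Proof.
move=> kj; pose leT a b := c b <= c a.
have leT_tr : transitive leT by move=> a b d ab bd; apply: leq_trans bd ab.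
have leT_refl : reflexive leT by move=> a; apply: leqnn.
have leT_total : total leT by move=> a b; apply: leq_total.
set s := sort leT (iota 0 j).
have ss : sorted leT s := sort_sorted leT_total _.
have sz : size s = j by rewrite size_sort size_iota.
have us : uniq s by rewrite sort_uniq iota_uniq.
have ms a : (a \in s) = (a < j) by rewrite mem_sort mem_iota.
have nth_s i i' : i <= i' -> i' < j -> c (nth 0 s i') <= c (nth 0 s i).
  move=> ii ij; apply: (sorted_leq_nth leT_tr leT_refl 0 ss) => //;
  by rewrite inE sz //; apply: leq_ltn_trans ij.
(* The threshold is the frequency of the first letter left out; 0 will do when none is. *)
exists (mem (take k s)), (if k < j then (c (nth 0 s k))%:Z%R else 0%R); split.
- have /permP -> : perm_eq (iota 0 j) s by rewrite perm_sym perm_sort.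
  rewrite -size_filter -[RHS](@size_takel k _ s) ?sz //; apply/perm_size/uniq_perm.
  + exact: filter_uniq.
  + exact: take_uniq.
  + by move=> a; rewrite mem_filter; rewrite inE; apply: andb_idr => /mem_take.
- by move=> a ja; apply: contraL ja => /mem_take; rewrite ms -ltnNge.
- move=> a aj /=; rewrite in_take ?ms // => ik; case: ltnP => // kj'.
  by have := nth_s _ _ (ltnW ik) kj'; rewrite nth_index ?ms // lez_nat.
- move=> a aj /=; rewrite in_take ?ms // -leqNgt => ki.
  have ij : index a s < j by rewrite -sz index_mem ms.
  by have := nth_s _ _ ki ij; rewrite nth_index ?ms // (leq_ltn_trans ki ij) lez_nat.
Qed.

(** Together with [bounds_extremal]: the states between the extremal ones are exactly the
    [k]-subsets of {0, ..., j-1}. *)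
Lemma extremal_bounds k j H : k <= j -> steps H -> H 0 = 0 ->
  (forall x, j <= x -> H x = k) ->
  below (extremal k j 0) H /\ below H (extremal k j k).
Proof.
move=> kj sH H0 Hj; have Hk x : x <= j -> H x <= k /\ k <= H x + (j - x).
  by move=> /(steps_le sH); rewrite (Hj j).
have Hx x : H x <= x by have := steps_le sH (leq0n x); rewrite H0; lia.
by split=> x; have := Hx x; rewrite /extremal;
  have [/Hk|/ltnW/Hj] := leqP x j; lia.
Qed.

Lemma bounds_extremal k j H : k <= j ->
  below (extremal k j 0) H -> below H (extremal k j k) ->
  H 0 = 0 /\ forall x, j <= x -> H x = k.
Proof.
move=> kj lo hi; split=> [|x jx]; first by have := hi 0; rewrite /extremal; lia.
by have := hi x; have := lo x; rewrite /extremal; lia.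
Qed.

Lemma traj_reach W P Q (T : nat -> nat -> nat) :
  (forall t, t < size W -> steps (T t)) ->
  (forall t, t.+1 < size W -> below (T t.+1) (T t)) ->
  (forall t, t < size W -> below (T t) P /\ below Q (T t)) -> below Q P ->
  reach W P Q (\sum_(t < size W) hit (T t) (nth 0 W t)).
Proof.
elim: W P T => [|x W IH] P T sT dT bT QP; first by rewrite big_ord0; constructor.
have [TP QT] := bT 0 isT.
rewrite big_ord_recl; apply: (@reach_cons _ _ _ (T 0)) => //; first exact: sT.

apply: (IH (T 0) (fun t => T t.+1)) => //.
- by move=> t tW; apply: sT.
- by move=> t tW; apply: dT.
- move=> t tW; have [_ QTt] := bT t.+1 tW; split=> //.
  elim: t tW {QTt} => [|t IHt] tW; first exact: dT.
  by apply: below_trans (IHt (ltnW tW)) (dT _ _).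
Qed.

Local Open Scope ring_scope.

(** Hits are differences of the counting function, hence additive in [T = H + a - b], where [b] runs
    backwards in time. *)
Lemma hits_decomposition (T a b : nat -> nat -> nat) H (W : seq nat) :
  steps H -> (forall t, (t < size W)%N -> steps (T t)) ->
  (forall t x, (t < size W)%N ->
     (T t x + b (size W - t.+1) x = H x + a t x)%N) ->
  (\sum_(t < size W) hit (T t) (nth 0 W t))%N%:Z =
    (\sum_(x <- W) hit H x)%N%:Z + gain a W - gain b (rev W).
Proof.
move=> sH sT TE; rewrite (big_nth 0%N) big_mkord /gain size_rev.
rewrite [X in _ - X](reindex_inj rev_ord_inj) /= -!natz !natr_sum -big_split -sumrB.
apply: eq_bigr => t _; have tW := ltn_ord t.
rewrite nth_rev; last by rewrite subnS; lia.
have -> : (size W - (size W - t.+1).+1 = t)%N by lia.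
rewrite !natz /hit /=; set x := nth _ _ _.
by have := sT t tW x; have := sH x; have := TE t x tW; have := TE t x.+1 tW; lia.
Qed.

Lemma gain_eq A (h : nat -> nat -> nat) (W W' : seq nat) :
  (forall t x, (A <= t)%N -> h t x = 0%N) ->
  size W = size W' -> take A W = take A W' -> gain h W = gain h W'.
Proof.
move=> hA sW tW; rewrite /gain -sW; apply: eq_bigr => t _.
have [At|tA] := leqP A t; first by rewrite !hA.
by rewrite -(nth_take 0%N tA W) tW nth_take.
Qed.

Local Close Scope ring_scope.

(** Truncated subtraction yields the positive and negative parts of [T - H]. The second grows with
    time, hence the reversal. *)
Lemma admissible_trunc (j : nat) (D : pred nat) (H : nat -> nat)
    (T : nat -> nat -> nat) k :
  (forall x, H x.+1 = H x + D x) -> H 0 = 0 -> (forall x, j <= x -> H x = k) ->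
  (forall t, steps (T t)) -> (forall t, below (T t.+1) (T t)) ->
  (forall t, T t 0 = 0) -> (forall t x, j <= x -> T t x = k) ->
  admissible j (predC D) (fun t x => T t x - H x) /\
  forall L, admissible j D (fun t x => H x - T (L - t.+1) x).
Proof.
move=> HD H0 Hj sT dT T0 Tj; split=> [|L]; split.
- by move=> t x; have := dT t x; lia.
- by move=> t; rewrite T0.
- by move=> t x jx; rewrite Tj // Hj // subnn.
- by move=> t a; have := sT t a; rewrite HD /=; case: (D a) => /=; lia.
- move=> t x; have [tL|Lt] := ltnP t.+1 L.
    have -> : L - t.+1 = (L - t.+2).+1 by lia.
    by have := dT (L - t.+2) x; lia.
  by have -> : L - t.+2 = L - t.+1 by lia.
- by move=> t; rewrite H0.
- by move=> t x jx; rewrite Tj // Hj // subnn.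
- by move=> t a; have := sT (L - t.+1) a; rewrite HD /=; case: (D a) => /=; lia.
Qed.

Lemma rev_subst_word (T : Type) (phi : bool -> seq T) u :
  rev (subst_word phi u) = subst_word (fun b => rev (phi b)) (rev u).
Proof.
elim: u => // b u IH; rewrite /subst_word rev_cons map_rcons flatten_rcons.
by rewrite /= rev_cat IH.
Qed.

(** * Exchanging the middle block *)

Section Swap.
Variables (phi : bool -> seq nat) (K : nat) (c : nat -> nat).
Hypotheses (size_phi : forall b, size (phi b) = K)
  (count_phi : forall b (a : nat), count_mem a (phi b) = c a).
Variables (n : nat) (R : seq bool).
Hypotheses (n0 : 0 < n) (richR : rich n R) (R0 : 0 < size R).

Let w := flatten (nseq (n * n.+1) R).

Lemma count_subst_word u (a : nat) :
  count_mem a (subst_word phi u) = size u * c a.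
Proof. by elim: u => //= b u IH; rewrite count_cat IH count_phi mulSn. Qed.

Lemma greene_swap k j Y Y' : k <= j <= n -> size Y = size Y' ->
  greene_le k j (subst_word phi (w ++ Y ++ rev w))
                (subst_word phi (w ++ Y' ++ rev w)).
Proof.
move=> /andP[kj jn] YY v; set u := w ++ _; set u' := w ++ _.
set W := subst_word phi u; set W' := subst_word phi u' => rW.
have uu : size u = size u' by rewrite !size_cat YY.
have sW : size W = size u * K := size_subst_word size_phi u.
have sW' : size W' = size W by rewrite sW uu; apply: size_subst_word.
pose L := size W; pose A := size w * K.
have AL : A + A <= L.
  by rewrite /L sW /u !size_cat size_rev !mulnDl -/A; lia.
have [T0 [sT0 dT0 bT0 ->]] := reach_traj rW.
(* Beyond the word the trajectory stays in the final state, so that it is defined at all times. *)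
pose T t := if t < L then T0 t else extremal k j 0.
have sT t : steps (T t).
  by rewrite /T; case: ifP => [/sT0 //|_]; apply: extremal_steps.
have bT t : below (extremal k j 0) (T t) /\ below (T t) (extremal k j k).
  rewrite /T; case: ifP => _; first by have [] := bT0 t.
  by split; [apply: below_refl|apply: extremal_le].
have dT t : below (T t.+1) (T t).
  rewrite /T; have [tL|Lt] := ltnP t.+1 L; first by rewrite (ltnW tL).
  by case: ifP => [_|_]; [have [] := bT0 t|apply: below_refl].
have Tend t := bounds_extremal kj (proj1 (bT t)) (proj2 (bT t)).
have [D [theta [cD Dj Dge Dle]]] := top_letters c kj.
pose H x := count D (iota 0 x).
have HD x : H x.+1 = H x + D x.
  by rewrite /H -addn1 iotaD count_cat /= addn0.
have sH : steps H by move=> x; rewrite HD; case: (D x) => /=; lia.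
have Hj x : j <= x -> H x = k.
  move=> jx; rewrite /H -(subnKC jx) iotaD count_cat cD.
  rewrite [X in _ + X](_ : _ = 0) ?addn0 //; apply/eqP.
  rewrite eqn0Ngt -has_count -all_predC; apply/allP => a.
  by rewrite mem_iota add0n => /andP[/Dj].
have [adL adR] := @admissible_trunc j D H T k HD erefl Hj sT dT
  (fun t => proj1 (Tend t)) (fun t => proj2 (Tend t)).
have sgnL x : x < j -> if predC D x then (1 * ((c x)%:Z - theta) <= 0)%R
                        else (0 <= 1 * ((c x)%:Z - theta))%R.
  by move=> xj /=; have := Dge x xj; have := Dle x xj; case: (D x) => /=; lia.
(* The gain of the part above [H] counts negatively, hence the sign -1. *)
have sgnR x : x < j -> if D x then ((-1) * ((c x)%:Z - theta) <= 0)%R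
                        else (0 <= (-1) * ((c x)%:Z - theta))%R.
  by move=> xj /=; have := Dge x xj; have := Dle x xj; case: (D x) => /=; lia.
have [a [[a_t a_0 a_j aD] aA gainL]] := straighten size_phi count_phi
  (Y ++ rev w) n0 jn richR R0 sgnL adL.
have [b [[b_t b_0 b_j bD] bA gainR]] := straighten
  (fun b => etrans (size_rev (phi b)) (size_phi b))
  (fun b x => etrans (count_rev (pred1 x) (phi b)) (count_phi b x))
  (rev Y ++ rev w) n0 jn richR R0 sgnR (adR L).
have revW Z : subst_word (fun b => rev (phi b)) (w ++ rev Z ++ rev w) =
    rev (subst_word phi (w ++ Z ++ rev w)).
  by rewrite rev_subst_word !rev_cat revK catA.
rewrite revW -/u -/W in gainR; rewrite -/w -/u -/W in gainL.
(* The new [a] lives on the first [A] letters and the new [b] on the last [A]; as [A + A <= L] they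
   never overlap, which makes [T'] a state, equal to [H] over the middle block. *)
have AA t : t < L -> (forall x, a t x = 0) \/ (forall x, b (L - t.+1) x = 0).
  move=> tL; case: (leqP A t) => At; [left => x|right => x]; first exact: aA.
  by apply: bA; rewrite -/A; lia.
have bH t x : b t x <= H x.
  elim: x => [|x IH]; first by rewrite b_0.
  by have := bD t x; rewrite HD; case: (D x) => /=; lia.
pose T' t x := H x + a t x - b (L - t.+1) x.
have sT' t : t < L -> steps (T' t).
  move=> tL x; rewrite /T' HD; have := aD t x; have := bD (L - t.+1) x.
  have := bH (L - t.+1) x; have := bH (L - t.+1) x.+1; rewrite HD.
  by case: (AA t tL) => z; rewrite !z /=; case: (D x) => /=; lia.
have dT' t : t.+1 < L -> below (T' t.+1) (T' t).
  move=> tL x; rewrite /T'; have := a_t t x; have := b_t (L - t.+2) x.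
  by rewrite (_ : (L - t.+2).+1 = L - t.+1); [lia|lia].
have T'0 t : T' t 0 = 0 by rewrite /T' a_0 b_0.
have T'j t x : j <= x -> T' t x = k by move=> jx; rewrite /T' a_j // b_j // Hj //; lia.
have bT' t (tL : t < L) := extremal_bounds kj (sT' t tL) (T'0 t) (T'j t).
have QP : below (extremal k j 0) (extremal k j k) by apply: extremal_le.
exists (\sum_(t < size W') hit (T' t) (nth 0 W' t)); last first.
  by apply: traj_reach => // t; rewrite sW'; [apply: sT'|apply: dT'|case/bT'].
have -> : \sum_(t < size W) hit (T0 t) (nth 0 W t) =
    \sum_(t < size W) hit (T t) (nth 0 W t).
  by apply: eq_bigr => t _; rewrite /T ltn_ord.
rewrite -lez_nat (@hits_decomposition T (fun t x => T t x - H x)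
  (fun t x => H x - T (L - t.+1) x) H) //; last first.
  move=> t x tW; rewrite (_ : L - (size W - t.+1).+1 = t); first by lia.
  by rewrite -/L; rewrite -/L in tW; lia.
rewrite (@hits_decomposition T' a b H W') //; first last.
  move=> t x; rewrite sW' -/L => tL; rewrite /T'.
  by have := bH (L - t.+1) x; case: (AA t tL) => ->; lia.
  by move=> t; rewrite sW'; apply: sT'.
have -> : \sum_(x <- W') hit H x = \sum_(x <- W) hit H x.
  apply: perm_big; rewrite /perm_eq; apply/allP => x _ /=.
  by rewrite !count_subst_word uu.
have takeA (psi : bool -> seq nat) Z : (forall b, size (psi b) = K) ->
    take A (subst_word psi (w ++ Z)) = subst_word psi w.
  by move=> sz; rewrite subst_word_cat take_size_cat //; apply: size_subst_word.
(* [W] and [W'] share their first [A] letters, and so do their reversals. *)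
have -> : gain a W' = gain a W by apply: (@gain_eq A); rewrite // !takeA.
have -> : gain b (rev W') = gain b (rev W).
  apply: (@gain_eq A) => //; first by rewrite !size_rev.
  by rewrite -!revW !takeA // => b'; rewrite size_rev.
lia.
Qed.
End Swap.

(** * The identity in the plactic monoid *)

(** The letters [false] on both sides keep runs of [true] inside one block. *)
Definition block (y : seq bool) := false :: rcons y false.

Definition blocks ys := flatten (map block ys).

Definition all_words m := [seq tval t | t <- enum {: m.-tuple bool}].

Lemma mem_all_words m y : size y = m -> y \in all_words m.
Proof.
move=> /eqP sy; apply/mapP; exists (Tuple sy) => //; exact: mem_enum.
Qed.

Lemma size_all_words m y : y \in all_words m -> size y = m.
Proof. by move=> /mapP[t _ ->]; rewrite size_tuple. Qed.

Lemma rich_blocks n : rich n (blocks (all_words n.-1)).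
Proof.
move=> y sy; set y' := y ++ nseq (n.-1 - size y) true.
have : y' \in all_words n.-1 by apply: mem_all_words; rewrite size_cat size_nseq subnKC.
case/splitPr => s1 s2; rewrite /blocks map_cat flatten_cat /=.
exists (size (flatten (map block s1))).+1.
  rewrite size_cat /= size_cat size_rcons.
  have : size y <= size y' by rewrite size_cat leq_addr.
  lia.
move=> i iy; rewrite nth_cat ifN; last lia.
rewrite addSn subSn ?leq_addr // addKn /= -cats1 -!catA nth_cat iy //.
Qed.

Lemma size_blocks_gt0 m : 0 < size (blocks (all_words m)).
Proof.
have := mem_all_words (size_nseq m true).
by case: (all_words m).
Qed.

Lemma flatten_nseq_blocks N ys :
  flatten (nseq N (blocks ys)) = blocks (flatten (nseq N ys)).
Proof. by elim: N => //= N ->; rewrite /blocks map_cat flatten_cat. Qed.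

Lemma rev_blocks ys : rev (blocks ys) = blocks (map rev (rev ys)).
Proof.
rewrite /blocks rev_flatten -!map_rev -!map_comp; congr flatten.
by apply: eq_map => y /=; rewrite /block rev_cons rev_rcons.
Qed.

(* No [n] consecutive letters [true] in a word that is preceded by [q] of them. *)
Fixpoint run_free n q s :=
  match s with
  | true :: s' => (q.+1 < n) && run_free n q.+1 s'
  | false :: s' => run_free n 0 s'
  | [::] => true
  end.

Lemma run_free_le n q q' s : q <= q' -> run_free n q' s -> run_free n q s.
Proof.
elim: s q q' => [|[] s IH] q q' qq //= /andP[q'n rf].
by rewrite (leq_ltn_trans _ q'n) //=; apply: IH rf.
Qed.

Lemma run_free_blocks n ys s : 0 < n -> all (fun y => size y < n) ys ->
  run_free n 0 s -> run_free n 0 (blocks ys ++ s).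
Proof.
move=> n0; elim: ys => //= y ys IH /andP[yn /IH{}IH rf].
rewrite /= cat_rcons -catA cat_cons -/(blocks ys); have {IH rf} := IH rf.
move: (blocks ys ++ s) => s'; have : 0 + size y < n by [].
elim: y {1 3}0 {yn} => [|b y IH] q //= qn rf.
have {}qn : q.+1 + size y < n by rewrite addSnnS.
by case: b; rewrite IH //; lia.
Qed.

Section Identity.
Variable n : nat.

Definition prefix_word := flatten (nseq (n * n.+1) (blocks (all_words n.-1))).

Definition slot (b : bool) := if b then [:: true; false] else [:: false; true].

(* [true] stands for the factor A = xy and the letter x, [false] for the factor B = yx
   and the letter y. *)
Definition side_slots (b : bool) := prefix_word ++ nseq n b ++ rev prefix_word.

Definition side (b : bool) := subst_word slot (side_slots b).

(** Each block contains a word of length [n.-1], too short for a run of length [n]; reversed blocks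
    are again blocks, and the middle is all [false]. *)
Lemma run_free_side : 0 < n -> run_free n 0 (side_slots false).
Proof.
move=> n0; rewrite /side_slots /prefix_word flatten_nseq_blocks.
set ys := flatten _.
have sys : all (fun y => size y < n) ys.
  apply/allP => y /flattenP[s /nseqP[-> _] /size_all_words ->]; lia.
apply: run_free_blocks => //.
have -> s : run_free n 0 (nseq n false ++ s) = run_free n 0 s by elim: (n in nseq n _).
rewrite rev_blocks -[blocks _]cats0; apply: run_free_blocks => //.
by rewrite all_map all_rev; apply: sub_all sys => y /=; rewrite size_rev.
Qed.

(** The images of xy and yx have the same length and content, as [greene_swap] requires. *)
Lemma plactic_side (g : bool -> seq 'I_n) : 0 < n ->
  plactic_congr (subst_word g (side true)) (subst_word g (side false)).
Proof.
move=> n0; pose phi b := vals (subst_word g (slot b)).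
have size_phi b : size (phi b) = size (g true) + size (g false).
  by case: b; rewrite /phi /subst_word /vals size_map /= cats0 size_cat // addnC.
pose c a := count_mem a (vals (g true)) + count_mem a (vals (g false)).
have count_phi b a : count_mem a (phi b) = c a.
  case: b; rewrite /phi /subst_word /vals /= cats0 map_cat count_cat //.
  by rewrite addnC.
have E b : vals (subst_word g (side b)) = subst_word phi (side_slots b).
  rewrite /side; elim: (side_slots b) => //= x s IH.
  rewrite -/(subst_word slot s) subst_word_cat /vals map_cat; exact: (congr1 _ IH).
have sw b b' k j : k <= j <= n ->
    greene_le k j (vals (subst_word g (side b))) (vals (subst_word g (side b'))).
  move=> kjn; rewrite !E; apply: (greene_swap size_phi count_phi) => //.
  - exact: rich_blocks.
  - exact: size_blocks_gt0.
  - by rewrite !size_nseq.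
by apply: greene_plactic => k j; apply: sw.
Qed.

Lemma side_neq_nil b : 0 < n -> side b != [::].
Proof.
rewrite /side /side_slots !subst_word_cat -!size_eq0 !size_cat.
by case: n => // m _; case: b; rewrite /= !addnS.
Qed.
End Identity.

Lemma morphism_plactic n (f : {multiplicative free_semigroup bool -> plactic n})
    (u : free_semigroup bool) :
  f u = plactic_class (subst_word
    (fun b => repr (f (@FreeSemigroup bool [:: b] isT))) (word_of u)).
Proof.
case: u => s; elim: s => [|b s IH] ps //.
have [s0|s0] := eqVneq s [::].
  subst s; rewrite /subst_word /= cats0 plactic_classK.
  by congr (f _); apply: val_inj.
have -> : FreeSemigroup ps =
    (@FreeSemigroup bool [:: b] isT * FreeSemigroup s0)%g by apply: val_inj.
rewrite gmulfM (IH s0) -[X in (X * _)%g]plactic_classK.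
exact: plactic_mul_class.
Qed.

(** * The identity in upper triangular tropical matrices *)

Section Bounds.
Variable R : realType.
Implicit Types (x y : tropical R) (z : int).
Local Open Scope ring_scope.

Definition tint z : tropical R := @Tropical R (z%:~R)%:E isT.

Definition tle x z := (trop_val x <= (z%:~R)%:E)%E.
Definition tge x z := ((z%:~R)%:E <= trop_val x)%E.

Lemma tint_mul z z' : tint z * tint z' = tint (z + z').
Proof. by apply: val_inj; rewrite /= intrD EFinD. Qed.

Lemma tle_tint z z' : tle (tint z) z' = (z <= z').
Proof. by rewrite /tle /= lee_fin ler_int. Qed.

Lemma tge_tint z z' : tge (tint z) z' = (z' <= z).
Proof. by rewrite /tge /= lee_fin ler_int. Qed.

Lemma tle0 z : tle 0 z. Proof. by rewrite /tle /= leNye. Qed.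

Lemma tle_trans x z z' : z <= z' -> tle x z -> tle x z'.
Proof. by move=> zz xz; apply: le_trans xz _; rewrite lee_fin ler_int. Qed.

Lemma tge_trans x z z' : z' <= z -> tge x z -> tge x z'.
Proof. by move=> zz; apply: le_trans; rewrite lee_fin ler_int. Qed.

Lemma tle_mul x y z z' : tle x z -> tle y z' -> tle (x * y) (z + z').
Proof. by move=> xz yz; rewrite /tle /= intrD EFinD; apply: leeD. Qed.

Lemma tge_mul x y z z' : tge x z -> tge y z' -> tge (x * y) (z + z').
Proof. by move=> xz yz; rewrite /tge /= intrD EFinD; apply: leeD. Qed.

Lemma tle_sum (I : finType) (F : I -> tropical R) z :
  (forall i, tle (F i) z) -> tle (\sum_i F i) z.
Proof.
move=> Fz; apply: (big_ind (fun x => tle x z)) => //; first exact: tle0.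
by move=> x y xz yz; rewrite /tle /= ge_max; apply/andP.
Qed.

Lemma tge_sum (I : finType) (F : I -> tropical R) z i :
  tge (F i) z -> tge (\sum_i F i) z.
Proof.
by move=> Fz; rewrite (bigD1 i) //= /tge /= le_max; apply/orP; left.
Qed.

Lemma tle_lt_tge x z z' : tle x z -> tge x z' -> z' <= z.
Proof. by move=> xz xz'; rewrite -(ler_int R) -lee_fin; apply: le_trans xz' xz. Qed.

End Bounds.

(** * The separating bidiagonal matrices *)

Section Separation.
Variables (R : realType) (n : nat).
Local Open Scope ring_scope.

(* With diagonal [i] in y and [weight i - i] in x, the factors xy and yx have the same
   diagonal, but different entries above it. *)
Definition weight (i : nat) : int := ((i == 0%N) || (i == n))%:Z.

Definition mx_x : 'M[tropical R]_n.+1 := \matrix_(i, j)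
  if j == i then tint R (weight i - i%:Z)
  else if (j == i.+1 :> nat) then tint R (- i.+1%:Z) else 0.

Definition mx_y : 'M[tropical R]_n.+1 := \matrix_(i, j)
  if j == i then tint R i%:Z else 0.

Lemma mx_x_upper : [forall i : 'I_n.+1, forall j : 'I_n.+1,
  (j < i)%N ==> (mx_x i j == 0)].
Proof.
apply/forallP => i; apply/forallP => j; apply/implyP => ji; rewrite mxE.
have -> : (j == i) = false by rewrite -val_eqE ltn_eqF.
by rewrite ltn_eqF // ltnW.
Qed.

Lemma mx_y_upper : [forall i : 'I_n.+1, forall j : 'I_n.+1,
  (j < i)%N ==> (mx_y i j == 0)].
Proof.
apply/forallP => i; apply/forallP => j; apply/implyP => ji; rewrite mxE.
by have -> : (j == i) = false by rewrite -val_eqE ltn_eqF.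
Qed.

Definition gen_UT (b : bool) : UT R n.+1 :=
  if b then UTMatrix mx_x_upper else UTMatrix mx_y_upper.

(** The fold starts from the first letter, [UT] being treated as a semigroup without unit. *)
Definition eval_UT (u : free_semigroup bool) : UT R n.+1 :=
  let: b := head true (word_of u) in
  foldl (fun A b => (A * gen_UT b)%g) (gen_UT b) (behead (word_of u)).

Lemma eval_UT_morph : {morph eval_UT : u v / (u * v)%g}.
Proof.
case=> [[//|b s] ps] [[//|b' s'] ps'].
rewrite /eval_UT /= foldl_cat /=.
move: (foldl _ _ s) => A; elim/last_ind: s' {ps'} => [|s' d IH] //.
by rewrite !foldl_rcons IH mulgA.
Qed.

HB.instance Definition _ :=
  isMultiplicative.Build (free_semigroup bool) (UT R n.+1) eval_UT eval_UT_morph.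

Definition mx_word (s : seq bool) : 'M[tropical R]_n.+1 :=
  foldr (fun b A => UT_mx (gen_UT b) *m A) 1%:M s.

Lemma mx_word_cat s s' : mx_word (s ++ s') = mx_word s *m mx_word s'.
Proof. by elim: s => [|b s IH] /=; rewrite ?mul1mx // IH mulmxA. Qed.

Lemma eval_UT_mx u : UT_mx (eval_UT u) = mx_word (word_of u).
Proof.
case: u => [[//|b s] ps]; rewrite /eval_UT /=.
elim/last_ind: s {ps} => [|s d IH] /=; first by rewrite mulmx1.
by rewrite foldl_rcons -cats1 mx_word_cat mulmxA -IH /= mulmx1.
Qed.

Definition mx_slot b := mx_word (slot b).

Lemma mx_slotE b (i j : 'I_n.+1) : mx_slot b i j =
  if j == i then tint R (weight i)
  else if (j == i.+1 :> nat) then tint R (if b then 0 else - 1) else 0.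
Proof.
have yE : mx_y = diag_mx (\row_i tint R i%:Z).
  by apply/matrixP => k l; rewrite !mxE eq_sym; case: eqP.
case: b; rewrite /mx_slot /= mulmx1 yE ?mul_mx_diag ?mul_diag_mx !mxE.
  have [->|_] := eqVneq j i; first by rewrite tint_mul subrK.
  have [->|_] := eqVneq (j : nat) i.+1; last by rewrite mul0r.
  by rewrite tint_mul addNr.
have [_|_] := eqVneq j i; first by rewrite tint_mul addrC subrK.
have [_|_] := eqVneq (j : nat) i.+1; last by rewrite mulr0.
by rewrite tint_mul; congr tint; lia.
Qed.

(** The best weight of a path from [i] to [n] that stays or moves up by one at each factor. *)
Definition col_entry (s : seq bool) (i : 'I_n.+1) : tropical R :=
  mx_word (subst_word slot s) i ord_max.

Lemma col_entry_cons b s i :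
  col_entry (b :: s) i = \sum_k mx_slot b i k * col_entry s k.
Proof. by rewrite /col_entry /subst_word /= mx_word_cat mxE. Qed.

Lemma col_entry_le b s (i : 'I_n.+1) (z : int) :
  tle (col_entry s i) (z - weight i) ->
  (forall k : 'I_n.+1, k = i.+1 :> nat ->
     tle (col_entry s k) (z + (if b then 0 else 1))) ->
  tle (col_entry (b :: s) i) z.
Proof.
move=> zi zk; rewrite col_entry_cons; apply: tle_sum => k; rewrite mx_slotE.
have [->|_] := eqVneq k i.
  rewrite -[z](subrKC (weight i)); apply: tle_mul => //.
  by rewrite tle_tint.
have [ki|_] := eqVneq (k : nat) i.+1; last first.
  by rewrite mul0r; apply: tle0.
have := tle_mul (_ : tle (tint R (if b then 0 else -1)) (if b then 0 else -1))
  (zk k ki).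
by rewrite tle_tint => /(_ (lexx _)); apply: tle_trans; case: b {zk}; lia.
Qed.

Lemma col_entry_ge (b : bool) s (i k : 'I_n.+1) (z : int) :
  k = i :> nat /\ tge (col_entry s k) (z - weight i) \/
  [/\ b, k = i.+1 :> nat & tge (col_entry s k) z] ->
  tge (col_entry (b :: s) i) z.
Proof.
move=> h; rewrite col_entry_cons; apply: (tge_sum (i := k)); rewrite mx_slotE.
case: h => [[/val_inj -> zi]|[-> ki zk]].
  rewrite eqxx -[z](subrKC (weight i)); apply: tge_mul => //.
  by rewrite tge_tint.
rewrite -val_eqE /= ki eqxx ifF; last lia.
by rewrite -[z]add0r; apply: tge_mul => //; rewrite tge_tint.
Qed.

Lemma col_entry_nil i : col_entry [::] i = if i == ord_max then 1 else 0.
Proof. by rewrite /col_entry /= !mxE; case: eqP. Qed.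

Lemma tle1 z : tle (1 : tropical R) z = (0 <= z).
Proof. exact: (tle_tint R 0 z). Qed.

Lemma tge1 z : tge (1 : tropical R) z = (z <= 0).
Proof. exact: (tge_tint R 0 z). Qed.

(** The [n - i] factors spent on moves earn at most 0, all others at most 1. *)
Lemma col_entry_upper s (i : 'I_n.+1) : (0 < i)%N ->
  tle (col_entry s i) ((size s)%:Z - (n - i)%:Z).
Proof.
elim: s i => [|b s IH] i i0.
  rewrite col_entry_nil; case: eqP => [->|_]; last exact: tle0.
  by rewrite tle1 /=; lia.
apply: col_entry_le => [|k ki].
  apply: tle_trans (IH i i0); rewrite /weight /=; have := ltn_ord i.
  by case: eqP => //=; [lia|case: eqP; lia].
apply: tle_trans (IH k _); last by rewrite ki.
by have := ltn_ord k; rewrite ki /=; case: b; lia.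
Qed.

(** Being at [i] stands for [i] moves made on the [i] preceding factors A. Without [n] consecutive
    A, a further unit is lost, by waiting strictly between 0 and [n] or by moving on a factor B. *)
Lemma col_entry_run_free s (i : 'I_n.+1) : (i < n)%N -> run_free n i s ->
  tle (col_entry s i) ((size s)%:Z - (n - i)%:Z - 1).
Proof.
elim: s i => [|b s IH] i iN.
  by move=> _; rewrite col_entry_nil -val_eqE /= ltn_eqF //; apply: tle0.
move=> rf; apply: col_entry_le => [|k ki].
  have [i0|iN0] := posnP i.
    apply: tle_trans (IH i iN _); last first.
      rewrite i0 in rf *; case: b rf => //= /andP[_]; exact: run_free_le.
    by rewrite /weight i0 /=; lia.
  apply: tle_trans (col_entry_upper s iN0); rewrite /weight /=.
  by rewrite (gtn_eqF iN0) (ltn_eqF iN) /=; lia.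
case: b rf => /= [/andP[iN' rf]|rf].
  by apply: tle_trans (IH k _ _); rewrite ki //; lia.
apply: tle_trans (col_entry_upper s _); first by rewrite ki; lia.
by rewrite ki.
Qed.

(** The path waits at 0 along [s], moves at each of the [n] factors A, and waits at [n] along
    [s']. *)
Lemma col_entry_lower s s' : (0 < n)%N ->
  tge (col_entry (s ++ nseq n true ++ s') ord0) ((size s)%:Z + (size s')%:Z).
Proof.
move=> n0; have last_ge : tge (col_entry s' ord_max) (size s')%:Z.
  elim: s' => [|b s' IH]; first by rewrite col_entry_nil eqxx tge1.
  apply: (@col_entry_ge _ _ _ ord_max); left; split=> //.
  by apply: tge_trans IH; rewrite /weight /= eqxx orbT; lia.
have run_ge m (i : 'I_n.+1) : (i + m = n)%N ->
    tge (col_entry (nseq m true ++ s') i) (size s')%:Z.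
  elim: m i => [|m IH] i im.
    by rewrite (_ : i = ord_max) //; apply: val_inj; rewrite /= -[LHS]addn0.
  have ilt : (i.+1 < n.+1)%N by lia.
  apply: (@col_entry_ge _ _ _ (Ordinal ilt)); right; split=> //.
  by apply: IH; rewrite /=; lia.
elim: s => [|b s IH]; first by rewrite add0r; apply: run_ge.
apply: (@col_entry_ge _ _ _ ord0); left; split=> //.
by apply: tge_trans IH; rewrite /weight /=; lia.
Qed.
End Separation.

Theorem corollary4p3 (R : realType) (n : nat) (hn : (0 < n)%N) :
  exists (Sigma : finType) (u v : free_semigroup Sigma),
    [/\ u <> v,
        satisfies_identity (plactic n) u v
      & ~ satisfies_identity (UT R n.+1) u v].
Proof.
pose u b := FreeSemigroup (side_neq_nil b hn).
suff nUT : ~ satisfies_identity (UT R n.+1) (u true) (u false).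
  exists bool, (u true), (u false); split=> // [uv|f].
    by apply: nUT => f; rewrite uv.
  by rewrite !morphism_plactic; apply/plactic_classP/plactic_side.
move=> /(_ (@eval_UT R n)) /(congr1 (@UT_mx R n.+1)).
rewrite !eval_UT_mx /= => /matrixP/(_ ord0 ord_max) e.
(* With [N] slots on each side, the corner entry is at least N - n on the left and at most N - n - 1
   on the right. *)
have := col_entry_lower R (prefix_word n) (rev (prefix_word n)) hn.
rewrite /col_entry -/(side_slots n true) -/(side n true) e => lo.
have := @col_entry_run_free R n (side_slots n false) ord0 hn (run_free_side hn).
move=> /tle_lt_tge /(_ lo); rewrite /side_slots !size_cat size_nseq size_rev.
by rewrite /=; lia.
Qed.
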